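(* Let $Z$ be a set, let $x$ and $y$ be two distinct symbols not in $Z$, let $w$ be an element of the free group $\langle Z\mid\emptyset\rangle$ on $Z$, and let $G=\langle \{x\}\,\dot\cup\,\{y\}\,\dot\cup\, Z\mid [x,y]w\rangle$ be the one-relator group with generating set $\{x,y\}\cup Z$ and the single relator $[x,y]w$. Then every maximal cyclic subgroup of $G$ is left relatively convex in $G$.
   Context: $[x,y]:=x^{-1}y^{-1}xy$. An order on a set is a transitive, trichotomous binary relation (a strict total order). A subgroup $H$ of a group $G$ is left relatively convex in $G$ if the left $G$-set $G/H$ of left cosets admits at least one $G$-invariant order. A maximal cyclic subgroup is a subgroup that is maximal, with respect to inclusion, among the cyclic subgroups. *)

(* Defs.v *)
(* MathComp, with the classical sets of MathComp-Analysis. *)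
From HB Require Import structures.
From Stdlib Require Import Relation_Operators.
From mathcomp Require Import all_boot.
From mathcomp Require Import boolp classical_sets.

Set Implicit Arguments.
Unset Strict Implicit.
Unset Printing Implicit Defensive.

Local Open Scope quotient_scope.
Local Open Scope classical_set_scope.
Local Open Scope group_scope.

(* The letter [(false, x)] stands for [x] and [(true, x)] for its formal
   inverse. *)
Definition word (X : Type) := seq (bool * X).

HB.instance Definition _ (X : Type) := gen_eqMixin (word X).
HB.instance Definition _ (X : Type) := gen_choiceMixin (word X).

Section FreeGroup.
Variable X : Type.
Implicit Types u v s t : word X.

Inductive cancel_step : word X -> word X -> Prop :=
  CancelStep u v (b : bool) (x : X) :
    cancel_step (u ++ [:: (b, x), (~~ b, x) & v]) (u ++ v).

Definition word_eqv := clos_refl_sym_trans (word X) cancel_step.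

Definition word_eqvb u v : bool := `[< word_eqv u v >].

Lemma word_eqvb_equiv : equiv_class_of word_eqvb.
Proof.
split=> [u | u v | v u t].
- by apply/asboolP; apply: rst_refl.
- by apply/asbool_equiv_eq; split; apply: rst_sym.
- by move=> /asboolP uv /asboolP vt; apply/asboolP; apply: rst_trans vt.
Qed.

Canonical word_eqvb_rel := EquivRelPack word_eqvb_equiv.

Definition free_group := {eq_quot word_eqvb}.
HB.instance Definition _ := Choice.on free_group.
HB.instance Definition _ := EqQuotient.on free_group.

Lemma free_piP u v : (\pi_free_group u = \pi_free_group v) <-> word_eqv u v.
Proof.
split=> [/eqP|uv]; first by rewrite eqmodE => /asboolP.
by apply/eqP; rewrite eqmodE; apply/asboolP.
Qed.

Definition word_inv u : word X := rev [seq (~~ a.1, a.2) | a <- u].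

Lemma word_inv_cat u v : word_inv (u ++ v) = word_inv v ++ word_inv u.
Proof. by rewrite /word_inv map_cat rev_cat. Qed.

Lemma word_eqv_cat2l s u v : word_eqv u v -> word_eqv (s ++ u) (s ++ v).
Proof.
elim=> [_ _ [u' v' b x]|u'|u' v' _|u' v' t' _ IH1 _ IH2].
- by rewrite !catA; apply: rst_step.
- exact: rst_refl.
- exact: rst_sym.
- exact: rst_trans IH2.
Qed.

Lemma word_eqv_cat2r s u v : word_eqv u v -> word_eqv (u ++ s) (v ++ s).
Proof.
elim=> [_ _ [u' v' b x]|u'|u' v' _|u' v' t' _ IH1 _ IH2].
- by rewrite -!catA; apply: rst_step.
- exact: rst_refl.
- exact: rst_sym.
- exact: rst_trans IH2.
Qed.

Lemma word_eqv_inv u v : word_eqv u v -> word_eqv (word_inv u) (word_inv v).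
Proof.
elim=> [_ _ [u' v' b x]|u'|u' v' _|u' v' t' _ IH1 _ IH2].
- have -> : [:: (b, x), (~~ b, x) & v'] = [:: (b, x); (~~ b, x)] ++ v' by [].
  rewrite !word_inv_cat -catA /word_inv /= -/(word_inv _) negbK.
  exact: rst_step.
- exact: rst_refl.
- exact: rst_sym.
- exact: rst_trans IH2.
Qed.

Lemma word_mulVw u : word_eqv (word_inv u ++ u) [::].
Proof.
elim: u => [|[b x] u IHu]; first exact: rst_refl.
rewrite -cat1s word_inv_cat -catA; apply: rst_trans IHu.
by rewrite /word_inv /= -[b in (b, x) :: u]negbK; apply: rst_step.
Qed.

Lemma word_invK : involutive word_inv.
Proof.
move=> u; rewrite /word_inv map_rev revK -map_comp -[RHS]map_id.
by apply: eq_map => -[b x] /=; rewrite negbK.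
Qed.

Lemma word_mulwV u : word_eqv (u ++ word_inv u) [::].
Proof. by rewrite -{1}[u]word_invK; apply: word_mulVw. Qed.

Definition free_mul (a b : free_group) : free_group := \pi_free_group (repr a ++ repr b).
Definition free_one : free_group := \pi_free_group [::].
Definition free_inv (a : free_group) : free_group := \pi_free_group (word_inv (repr a)).

Lemma repr_free u : word_eqv (repr (\pi_free_group u)) u.
Proof. by apply/free_piP; rewrite reprK. Qed.

Lemma free_mulE u v : free_mul (\pi u) (\pi v) = \pi_free_group (u ++ v).
Proof.
apply/free_piP; apply: rst_trans (word_eqv_cat2l _ (repr_free v)).
exact/word_eqv_cat2r/repr_free.
Qed.

Lemma free_invE u : free_inv (\pi u) = \pi_free_group (word_inv u).
Proof. exact/free_piP/word_eqv_inv/repr_free. Qed.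

Lemma free_mulA : associative free_mul.
Proof.
by move=> a b c; rewrite -[a]reprK -[b]reprK -[c]reprK !free_mulE catA.
Qed.

Lemma free_mul1 : left_id free_one free_mul.
Proof. by move=> a; rewrite -[a]reprK free_mulE. Qed.

Lemma free_mulr1 : right_id free_one free_mul.
Proof. by move=> a; rewrite -[a]reprK free_mulE cats0. Qed.

Lemma free_mulV : left_inverse free_one free_inv free_mul.
Proof.
by move=> a; rewrite -[a]reprK free_invE free_mulE; apply/free_piP/word_mulVw.
Qed.

Lemma free_mulrV : right_inverse free_one free_inv free_mul.
Proof.
by move=> a; rewrite -[a]reprK free_invE free_mulE; apply/free_piP/word_mulwV.
Qed.

HB.instance Definition _ := isGroup.Build free_group
  free_mulA free_mul1 free_mulr1 free_mulV free_mulrV.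

Definition free_gen (x : X) : free_group := \pi_free_group [:: (false, x)].

End FreeGroup.

Section FreeLift.
Variables (X : Type) (H : groupType) (f : X -> H).

Definition word_eval (u : word X) : H :=
  \prod_(a <- u) (if a.1 then (f a.2)^-1 else f a.2).

Definition free_lift (a : free_group X) : H := word_eval (repr a).

Lemma word_eval_eqv u v : word_eqv u v -> word_eval u = word_eval v.
Proof.
elim=> [_ _ [u' v' b x]|u'|u' v' _ //|u' v' t' _ -> _ -> //].
  rewrite /word_eval !big_cat /= !big_cons /=.
  by case: b; rewrite /= ?mulKg ?mulVKg.
by [].
Qed.

Lemma free_liftE u : free_lift (\pi u) = word_eval u.
Proof. exact/word_eval_eqv/repr_free. Qed.

Lemma free_liftM : {morph free_lift : a b / a * b}.
Proof.
move=> a b; rewrite -[a]reprK -[b]reprK.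
by rewrite [_ * _]free_mulE !free_liftE /word_eval big_cat.
Qed.

Lemma free_lift1 : free_lift 1 = 1.
Proof. by rewrite [1]/(free_one X) free_liftE /word_eval big_nil. Qed.

HB.instance Definition _ :=
  isUMagmaMorphism.Build (free_group X) H free_lift (free_lift1, free_liftM).

Lemma free_lift_gen x : free_lift (free_gen x) = f x.
Proof. by rewrite free_liftE /word_eval big_seq1. Qed.

End FreeLift.

Section Subgroups.
Variable G : groupType.
Implicit Types (H : set G) (g : G).

Definition subgroup H : Prop := group_closed (mem H).

Definition normal_subgroup H : Prop :=
  subgroup H /\ forall g h : G, H h -> H (h ^ g).

Definition normal_closure (R : set G) : set G := smallest normal_subgroup R.

Definition cyclic_subgroup H : Prop :=
  exists g, H = smallest subgroup [set g].

Definition maximal_cyclic_subgroup H : Prop :=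
  cyclic_subgroup H /\
  forall K, cyclic_subgroup K -> H `<=` K -> K = H.

Definition left_translate g (A : set G) : set G := [set g * a | a in A].

Definition left_cosets H : set (set G) := [set left_translate g H | g in setT].

End Subgroups.

(* [lt] is a strict total order on the set [A]; its values outside [A] are
   irrelevant. *)
Definition strict_order_on (T : Type) (A : set T) (lt : T -> T -> Prop) : Prop :=
  (forall a b c, A a -> A b -> A c -> lt a b -> lt b c -> lt a c) /\
  (forall a b, A a -> A b ->
     [\/ [/\ lt a b, a <> b & ~ lt b a],
         [/\ ~ lt a b, a = b & ~ lt b a] |
         [/\ ~ lt a b, a <> b & lt b a]]).

Definition left_relatively_convex (G : groupType) (H : set G) : Prop :=
  subgroup H /\
  exists2 lt : set G -> set G -> Prop,
    strict_order_on (left_cosets H) lt &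
    forall (g : G) (A B : set G), left_cosets H A -> left_cosets H B ->
      lt A B -> lt (left_translate g A) (left_translate g B).

Section Presentation.
Variables (X : Type) (R : set (free_group X)).
Implicit Types a b c : free_group X.

Let N := normal_closure R.

Lemma closure1 : N 1.
Proof. by move=> K [[[]]]; rewrite inE. Qed.

Lemma closureM a b : N a -> N b -> N (a * b).
Proof.
move=> Na Nb K [nK RK]; have [gK _] := nK.
have := group_closedM gK; rewrite /mulg_closed => KM.
have := KM a b; rewrite !inE; apply; [exact: Na|exact: Nb].
Qed.

Lemma closureV a : N a -> N a^-1.
Proof.
move=> Na K [nK RK]; have [gK _] := nK.
have := group_closedV gK (x := a); rewrite !inE; apply; exact: Na.
Qed.

Lemma closureJ a g : N a -> N (a ^ g).
Proof. by move=> Na K KR; apply: KR.1.2; apply: Na. Qed.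

Definition pres_eqvb a b : bool := `[< N (a^-1 * b) >].

Lemma pres_eqvb_equiv : equiv_class_of pres_eqvb.
Proof.
split=> [a | a b | b a c].
- by apply/asboolP; rewrite mulVg; apply: closure1.
- by apply/asbool_equiv_eq; split=> /closureV; rewrite invgM invgK.
- move=> /asboolP ab /asboolP bc; apply/asboolP.
  by have := closureM ab bc; rewrite -mulgA mulVKg.
Qed.

Canonical pres_eqvb_rel := EquivRelPack pres_eqvb_equiv.

Definition presented_group := {eq_quot pres_eqvb}.
HB.instance Definition _ := Choice.on presented_group.
HB.instance Definition _ := EqQuotient.on presented_group.

Lemma pres_piP a b :
  (\pi_presented_group a = \pi_presented_group b) <-> N (a^-1 * b).
Proof.
split=> [/eqP|ab]; first by rewrite eqmodE => /asboolP.
by apply/eqP; rewrite eqmodE; apply/asboolP.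
Qed.

Definition pres_mul (p q : presented_group) : presented_group :=
  \pi_presented_group (repr p * repr q).
Definition pres_one : presented_group := \pi_presented_group 1.
Definition pres_inv (p : presented_group) : presented_group :=
  \pi_presented_group ((repr p)^-1).

Lemma repr_pres a : N ((repr (\pi_presented_group a))^-1 * a).
Proof. by apply/pres_piP; rewrite reprK. Qed.

Lemma pres_mulE a b : pres_mul (\pi a) (\pi b) = \pi_presented_group (a * b).
Proof.
apply/pres_piP; have := repr_pres a; have := repr_pres b.
set b' := repr _; set a' := repr _ => Nb Na.
have -> : (a' * b')^-1 * (a * b) = (a'^-1 * a) ^ b' * (b'^-1 * b).
  by rewrite conjgE invgM !mulgA mulgK.
by apply: closureM => //; apply: closureJ.
Qed.

Lemma pres_invE a : pres_inv (\pi a) = \pi_presented_group a^-1.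
Proof.
apply/pres_piP; have := repr_pres a; set a' := repr _ => Na.
have -> : a'^-1^-1 * a^-1 = ((a'^-1 * a)^-1) ^ a'^-1.
  by rewrite conjgE invgM !invgK !mulgA mulgK.
by apply: closureJ; apply: closureV.
Qed.

Lemma pres_mulA : associative pres_mul.
Proof.
by move=> a b c; rewrite -[a]reprK -[b]reprK -[c]reprK !pres_mulE mulgA.
Qed.

Lemma pres_mul1 : left_id pres_one pres_mul.
Proof. by move=> a; rewrite -[a]reprK pres_mulE mul1g. Qed.

Lemma pres_mulr1 : right_id pres_one pres_mul.
Proof. by move=> a; rewrite -[a]reprK pres_mulE mulg1. Qed.

Lemma pres_mulV : left_inverse pres_one pres_inv pres_mul.
Proof. by move=> a; rewrite -[a]reprK pres_invE pres_mulE mulVg. Qed.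

Lemma pres_mulrV : right_inverse pres_one pres_inv pres_mul.
Proof. by move=> a; rewrite -[a]reprK pres_invE pres_mulE mulgV. Qed.

HB.instance Definition _ := isGroup.Build presented_group
  pres_mulA pres_mul1 pres_mulr1 pres_mulV pres_mulrV.

End Presentation.

Inductive xyZ (Z : Type) : Type := sym_x | sym_y | sym_Z of Z.
Arguments sym_x {Z}.
Arguments sym_y {Z}.

Section OneRelator.
Variables (Z : Type) (w : free_group Z).

Let x : free_group (xyZ Z) := free_gen sym_x.
Let y : free_group (xyZ Z) := free_gen sym_y.

(* [[~ x, y]] is [x^-1 * (y^-1 * (x * y))]; [w], a free group element on [Z]
   only, is pushed along the inclusion of [Z] into the enlarged alphabet. *)
Definition xy_relator : free_group (xyZ Z) :=
  [~ x, y] * free_lift (fun z => free_gen (sym_Z z)) w.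

Definition xy_group : groupType := presented_group [set xy_relator].

End OneRelator.

(* Main.v *)
From HB Require Import structures.
Require Import Defs.
From mathcomp Require Import all_boot all_order all_algebra.
From mathcomp Require Import boolp classical_sets wochoice.
From mathcomp Require Import zify.

Set Implicit Arguments.
Unset Strict Implicit.
Unset Printing Implicit Defensive.

Import Order.TTheory GRing.Theory Num.Theory.
Local Open Scope group_scope.

(* The relator says [y ^ x = y w]. With [w_j = w ^ (x ^+ j)], it is solved by
   [y = t (w_0 w_1 w_2 ...)^-1] for any [t] commuting with [x], so [G] acts by
   noncommutative power series in [T] and [Z_(z, j)], twisted by the shift
   [j -> j + 1]: [x] is the shift, [z] is [1 + Z_(z, 0)] and [t] is [1 + T].
   Every element of [G] is conjugate by a power of [x] to some [h x ^+ k], where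
   [h] is a word in [y] and the [z ^ (x ^+ j)] with [j < 0]; on words in the
   variables [T] and [Z_(z, j)], [j < 0], the infinite product is invisible and
   Magnus' argument shows that the representation is faithful. The sign of the
   coefficient of the least monomial (words being compared by length, then
   lexicographically) is invariant under the shift, hence [G] is bi-ordered,
   the exponent of [x] being considered first.

   Let [C = <c>] be maximal cyclic in a bi-ordered group and [M] the centraliser
   of [c]. The [G]-set [G / M] is the conjugacy class of [c], so it is ordered.
   If [c] has [x]-exponent 0, the elements of [x]-exponent 0 whose least monomial
   is not below that of [c] form a convex subgroup [V], on which the coefficient
   [E] at that monomial is additive; otherwise let [V = G] and let [E] be the
   exponent of [x]. Replace [V] by its intersection with [M]. Finally [V / C] is
   ordered by the sign of [g ^+ n c ^- (E g)] with [n = E c], which is trivial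
   exactly when [g] and [c] have a common root. *)

(** * Integer powers, cyclic subgroups and common roots *)

Section Subgroups.
Variable G : groupType.
Implicit Types (H : set G) (g : G).

Lemma subgroupP H : subgroup H <->
  [/\ H 1, forall a b, H a -> H b -> H (a * b) & forall a, H a -> H a^-1].
Proof.
split=> [gH | [H1 HM HV]].
  split; first by have [] := gH; rewrite inE.
    by move=> a b; have := group_closedM gH (x := a) (y := b); rewrite !inE.
  by move=> a; have := group_closedV gH (x := a); rewrite !inE.
split; first by rewrite inE.
by move=> a b; rewrite !inE => Ha Hb; apply: HM => //; apply: HV.
Qed.

Lemma smallest_subgroupP A : subgroup (smallest (@subgroup G) A).
Proof.
apply/subgroupP; split=> [H [sH _]|a b Sa Sb H [sH AH]|a Sa H [sH AH]].
- by have /subgroupP[] := sH.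
- by have /subgroupP[_ HM _] := sH; apply: HM; [apply: Sa|apply: Sb].
- by have /subgroupP[_ _ HV] := sH; apply: HV; apply: Sa.
Qed.

Lemma subgroupJ H g : subgroup H -> subgroup [set a | H (a ^ g)]%classic.
Proof.
move=> /subgroupP[H1 HM HV]; apply/subgroupP; split=> [|a b|a] /=.
- by rewrite conj1g.
- by rewrite conjMg; apply: HM.
- by rewrite conjVg; apply: HV.
Qed.

Definition expgz g (k : int) : G :=
  match k with Posz n => g ^+ n | Negz n => g ^- n.+1 end.

Lemma expgz_sub g (m n : nat) : expgz g (Posz m - Posz n)%R = g ^+ m * g ^- n.
Proof.
case: (leqP n m) => [nm | mn].
  have -> : (Posz m - Posz n)%R = Posz (m - n)%N by lia.
  by rewrite /= expgnFr.
have -> : (Posz m - Posz n)%R = Negz (n - m).-1 by lia.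
by rewrite /= prednK ?subn_gt0 // expgnFr ?invgM ?invgK //; apply: ltnW.
Qed.

Lemma int_natB (k : int) : exists m n : nat, k = (Posz m - Posz n)%R.
Proof. by case: k => n; [exists n, 0|exists 0, n.+1]; lia. Qed.

Lemma commute_expV g m n : commute (g ^+ m) (g ^- n).
Proof. by apply/commuteV/commuteX2. Qed.

Lemma expgzD g (k l : int) : expgz g (k + l)%R = expgz g k * expgz g l.
Proof.
have [m [n ->]] := int_natB k; have [p [q ->]] := int_natB l.
have -> : (Posz m - Posz n + (Posz p - Posz q))%R = (Posz (m + p) - Posz (q + n))%R.
  by lia.
rewrite !expgz_sub !expgnDr invgM !mulgA; congr (_ * _).
by rewrite -!mulgA; congr (_ * _); apply: commute_expV.
Qed.

Lemma expgzN g (k : int) : expgz g (- k)%R = (expgz g k)^-1.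
Proof. by apply/esym/mulg1_eq; rewrite -expgzD subrr. Qed.

Lemma expgzM g (k : int) n : expgz g k ^+ n = expgz g (k * Posz n)%R.
Proof.
elim: n => [|n IHn]; first by rewrite mulr0.
by rewrite expgS IHn -expgzD; congr expgz; lia.
Qed.

Lemma expgz_mul g (k l : int) : expgz (expgz g k) l = expgz g (k * l)%R.
Proof.
case: l => n; first exact: expgzM.
by rewrite /= expgzM -expgzN; congr expgz; lia.
Qed.

Lemma commute_expgz g h (k : int) : commute g h -> commute g (expgz h k).
Proof. by move=> gh; case: k => n /=; [|apply: commuteV]; apply: commuteX. Qed.

Lemma expgzMn g h (k : int) :
  commute g h -> expgz (g * h) k = expgz g k * expgz h k.
Proof.
move=> gh; case: k => n /=; first by rewrite expgMn.
by rewrite gh expgMn ?invgM //; apply: commute_sym.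
Qed.

Lemma subgroup_expgz H g k : subgroup H -> H g -> H (expgz g k).
Proof.
move=> /subgroupP[H1 HM HV] Hg.
have HX n : H (g ^+ n) by elim: n => // n IHn; rewrite expgS; apply: HM.
by case: k => n /=; [|apply: HV]; apply: HX.
Qed.

Lemma cyclicE g :
  smallest (@subgroup G) [set g]%classic = [set expgz g k | k in setT]%classic.
Proof.
apply/seteqP; split=> [h|_ [k _ <-]].
  apply; split; last by move=> _ ->; exists 1%R.
  apply/subgroupP; split=> [|_ _ [k _ <-] [l _ <-]|_ [k _ <-]].
  - by exists 0%R.
  - by exists (k + l)%R; rewrite ?expgzD.
  - by exists (- k)%R; rewrite ?expgzN.
by move=> H [sH gH]; apply: subgroup_expgz => //; apply: gH.
Qed.

(** Maximality enters later as closure under roots of the generator: if [c] is a power of [d], the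
    cyclic group of [d] contains [C], hence equals it. *)
Lemma maximal_cyclicP C : maximal_cyclic_subgroup C ->
  exists c, C = [set expgz c k | k in setT]%classic /\
  forall d k, expgz d k = c -> C d.
Proof.
move=> [[c ->]]; rewrite cyclicE => maxC; exists c; split=> // d k dc.
rewrite -(maxC [set expgz d k | k in setT]%classic).
- by exists 1%R.
- by exists d; rewrite cyclicE.
- by move=> _ [i _ <-]; exists (k * i)%R; rewrite // -expgz_mul dc.
Qed.

(** Roots are unique among commuting elements of a torsion-free group. With Bezout coefficients
    [u n + v k = g], where [g] is the gcd, [d = c ^ u a ^ v] satisfies [d ^ n = c ^ g] and
    [d ^ k = a ^ g]; taking [g]-th roots gives [d ^ (n / g) = c] and [d ^ (k / g) = a]. *)
Lemma commute_root a c n (k : int) :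
    (forall g m, 0 < m -> g ^+ m = 1 -> g = 1) ->
    commute a c -> 0 < n -> a ^+ n = expgz c k ->
  exists d i j, expgz d i = c /\ expgz d j = a.
Proof.
move=> tfree ac n_gt0 ack.
have [u [v uv]] := Bezoutz n k.
set g := gcdz n k in uv; have g_gt0 : (0 < g)%R.
  by rewrite /g /gcdz /= ltz_nat gcdn_gt0 n_gt0.
have [n' Dn] : exists n', Posz n = (n' * g)%R.
  by exists (n %/ g)%Z; rewrite divzK // dvdz_gcdl.
have [k' Dk] : exists k', k = (k' * g)%R.
  by exists (k %/ g)%Z; rewrite divzK // dvdz_gcdr.
have ack' : expgz a n = expgz c k by [].
pose d := expgz c u * expgz a v.
have cac : commute (expgz c u) (expgz a v).
  by apply: commute_expgz; apply/commute_sym/commute_expgz.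
have root b e : commute b e -> expgz b g = expgz e g -> b = e.
  move=> be; case: g g_gt0 {uv Dn Dk} => // m; rewrite ltz_nat => m_gt0 /= bem.
  apply/divg1_eq; apply: (tfree _ m) => //.
  by rewrite expgnFl // bem mulgV.
have comd b : commute b c -> commute b a -> commute b d.
  by move=> bc ba; apply: commuteM; apply: commute_expgz.
exists d, n', k'; split; apply: root.
- apply/commute_sym/commute_expgz/comd => //; exact: commute_sym.
- rewrite expgz_mul -Dn /d expgzMn // !expgz_mul [(v * _)%R]mulrC.
  by rewrite -[expgz a _]expgz_mul ack' expgz_mul -expgzD -uv; congr expgz; lia.
- by apply/commute_sym/commute_expgz/comd.
- rewrite expgz_mul -Dk /d expgzMn // !expgz_mul [(u * _)%R]mulrC.
  by rewrite -[expgz c _]expgz_mul -ack' expgz_mul -expgzD -uv; congr expgz; lia.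
Qed.

End Subgroups.

Lemma preimage_subgroup (G K : groupType) (h : UMagmaMorphism.type G K)
    (H : set K) : subgroup H -> subgroup (h @^-1` H)%classic.
Proof.
move=> /subgroupP[H1 HM HV]; apply/subgroupP; split=> [|a b|a] /=.
- by rewrite gmulf1.
- by rewrite gmulfM; apply: HM.
- by rewrite gmulfV; apply: HV.
Qed.

Lemma gmulf_expgz (G K : groupType) (h : UMagmaMorphism.type G K) (g : G) k :
  h (expgz g k) = expgz (h g) k.
Proof. by case: k => n /=; rewrite ?gmulfV gmulfXn. Qed.

(** * Invariant orders on cosets as positive cones *)

Section Cones.
Variable G : groupType.
Implicit Types (H K L P Q : set G) (a b c g h : G).

(* [P] is the set of all [g] with [H < g H] for a [K]-invariant order on the
   left cosets of [H] in [K]. *)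
Record relative_cone K H P : Prop := RelativeCone {
  rcone_sub : forall a, P a -> K a;
  rconeM : forall a b, P a -> P b -> P (a * b);
  rcone_mull : forall h a, H h -> P a -> P (h * a);
  rcone_mulr : forall h a, H h -> P a -> P (a * h);
  rcone_tri : forall a, K a -> [\/ P a, H a | P a^-1];
  rcone_disj : forall a, P a -> ~ H a }.

(** The two orders combine lexicographically: cosets of [L] are compared first, then cosets of [H]
    inside one coset of [L]. *)
Lemma relative_cone_trans K L H P Q :
    (forall a, L a -> K a) -> (forall a, H a -> L a) ->
  relative_cone K L P -> relative_cone L H Q -> relative_cone K H (P `|` Q).
Proof.
move=> LK HL [PK PM Pl Pr Pt Pd] [QL QM Ql Qr Qt Qd]; split.
- by move=> a [/PK|/QL/LK].
- move=> a b [Pa|Qa] [Pb|Qb]; [left|left|left|right].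
  + exact: PM.
  + by apply: Pr => //; apply: QL.
  + by apply: Pl => //; apply: QL.
  + exact: QM.
- by move=> h a Hh [Pa|Qa]; [left; apply: Pl => //; apply: HL|right; apply: Ql].
- by move=> h a Hh [Pa|Qa]; [left; apply: Pr => //; apply: HL|right; apply: Qr].
- move=> a /Pt[Pa|/Qt[Qa|Ha|Qa]|Pa]; last by constructor 3; left.
  + by constructor 1; left.
  + by constructor 1; right.
  + by constructor 2.
  + by constructor 3; right.
- by move=> a [/Pd nL|/Qd //] /HL.
Qed.

Lemma relative_cone_convex H P :
  subgroup H -> relative_cone setT H P -> left_relatively_convex H.
Proof.
move=> sH [_ PM Pl Pr Pt Pd]; split=> //.
have /subgroupP[H1 HM HV] := sH.
(* Stability of [P] under multiplication by [H] on both sides makes the choice of representatives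
   immaterial; this is [ltE]. *)
pose lt (A B : set G) := exists a b, [/\ A a, B b & P (a^-1 * b)].
have ltE g h : lt (left_translate g H) (left_translate h H) <-> P (g^-1 * h).
  split=> [[_ [_ [[u Hu <-] [v Hv <-]]]]|Pgh].
    rewrite invgM -mulgA => Puv.
    have -> : g^-1 * h = u * (u^-1 * (g^-1 * (h * v))) * v^-1.
      by rewrite mulVKg !mulgA mulgK.
    by apply: Pr; [apply: HV|apply: Pl].
  by exists g, h; split=> //; [exists 1; rewrite ?mulg1..].
have cosetE g h : left_translate g H = left_translate h H <-> H (g^-1 * h).
  split=> [/seteqP[_ sub]|Hgh].
    have [|u Hu <-] := sub h; first by exists 1; rewrite ?mulg1.
    by rewrite mulKg.
  apply/seteqP; split=> _ [u Hu <-].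
    exists ((g^-1 * h)^-1 * u); first by apply: HM => //; apply: HV.
    by rewrite invgM invgK -!mulgA mulVKg.
  by exists (g^-1 * h * u); [apply: HM|rewrite -!mulgA mulVKg].
exists lt; last first.
  move=> g _ _ [a _ <-] [b _ <-] /ltE Pab.
  have tr u : left_translate g (left_translate u H) = left_translate (g * u) H.
    by rewrite /left_translate image_comp; under eq_imagel do rewrite /= mulgA.
  by rewrite !tr; apply/ltE; rewrite invgM -mulgA mulKg.
split=> [_ _ _ [a _ <-] [b _ <-] [d _ <-] /ltE ab /ltE bd|_ _ [a _ <-] [b _ <-]].
  by apply/ltE; have := PM _ _ ab bd; rewrite -mulgA mulVKg.
have P1 : ~ P 1 by move/Pd.
have asym u : P u -> ~ P u^-1.
  by move=> Pu Pu'; apply: P1; rewrite -(mulgV u); apply: PM.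
have invE : (b^-1 * a) = (a^-1 * b)^-1 by rewrite invgM invgK.
have [Pab|Hab|Pba] := Pt (a^-1 * b) I.
- constructor 1; split; [exact/ltE|by move/cosetE; apply: Pd|].
  by move/ltE; rewrite invE; apply: asym.
- constructor 2; split; [by move/ltE/Pd|exact/cosetE|].
  by move/ltE/Pd; apply; rewrite invE; apply: HV.
- constructor 3; split; [|by move/cosetE/HV; apply: Pd|by apply/ltE; rewrite invE].
  by move/ltE/asym.
Qed.

End Cones.

(** * Bi-ordered groups *)

Section BiOrder.
Variables (G : groupType) (P : set G).
Implicit Types (a b c g h : G) (V C : set G).

(** The set of elements above 1 in a bi-order: closure under conjugation makes the left-invariant
    [plt] right-invariant as well. *)
Record positive_cone : Prop := PositiveCone {
  pconeM : forall a b, P a -> P b -> P (a * b);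
  pconeJ : forall a g, P a -> P (a ^ g);
  pcone_tri : forall a, [\/ P a, a = 1 | P a^-1];
  pcone1 : ~ P 1 }.

Hypothesis posP : positive_cone.

Definition plt a b := P (a^-1 * b).
Definition ple a b := a = b \/ plt a b.

Lemma plt_trans a b c : plt a b -> plt b c -> plt a c.
Proof. by move=> ab bc; have := pconeM posP ab bc; rewrite -mulgA mulVKg. Qed.

Lemma plt_irr a : ~ plt a a.
Proof. by rewrite /plt mulVg; apply: pcone1 posP. Qed.

Lemma plt_mul2l g a b : plt a b -> plt (g * a) (g * b).
Proof. by rewrite /plt invgM -mulgA mulKg. Qed.

Lemma plt_mul2r g a b : plt a b -> plt (a * g) (b * g).
Proof. by move=> /(pconeJ posP g); rewrite /plt invgM conjgE !mulgA. Qed.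

Lemma plt_tri a b : [\/ plt a b, a = b | plt b a].
Proof.
have [ab|ab|ab] := pcone_tri posP (a^-1 * b).
- by constructor 1.
- by constructor 2; have := mulg1_eq ab; rewrite invgK.
- by constructor 3; move: ab; rewrite /plt invgM invgK.
Qed.

Lemma ple_total a b : ple a b \/ ple b a.
Proof. by case: (plt_tri a b) => [|->|]; by [left; left|left; right|right; right]. Qed.

Lemma ple_trans b a c : ple a b -> ple b c -> ple a c.
Proof.
move=> [->//|ab] [<-|bc]; right=> //; exact: plt_trans bc.
Qed.

Lemma plt_le_trans b a c : plt a b -> ple b c -> plt a c.
Proof. by move=> ab [<-//|]; apply: plt_trans. Qed.

Lemma ple_mul2l g a b : ple a b -> ple (g * a) (g * b).
Proof. by case=> [->|ab]; [left|right; apply: plt_mul2l]. Qed.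

Lemma ple_mul2r g a b : ple a b -> ple (a * g) (b * g).
Proof. by case=> [->|ab]; [left|right; apply: plt_mul2r]. Qed.

Lemma plt_mul a b g h : plt a b -> plt g h -> plt (a * g) (b * h).
Proof.
by move=> /(plt_mul2r g) ab /(plt_mul2l b); apply: plt_trans.
Qed.

Lemma pconeX a n : 0 < n -> P a -> P (a ^+ n).
Proof.
case: n => // n _ Pa; elim: n => // n IHn.
by rewrite expgS; apply: (pconeM posP).
Qed.

Lemma pcone_torsion_free a n : 0 < n -> a ^+ n = 1 -> a = 1.
Proof.
move=> n_gt0 an1; have [Pa|//|Pa] := pcone_tri posP a.
  by case: (pcone1 posP); rewrite -an1; apply: pconeX.
by case: (pcone1 posP); rewrite -invg1 -an1 -expVgn; apply: pconeX.
Qed.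

(** The word [(a b)^n] arises from [a^n b^n] by moving letters [b] leftwards across letters [a], and
    each exchange of [a b] for [b a] can only increase the element. [ple_expMn_rl] is the mirror
    case. *)
Lemma ple_expMn_lr a b n :
  ple (a * b) (b * a) -> ple (a ^+ n * b ^+ n) ((a * b) ^+ n).
Proof.
move=> ab; have abX k : ple (a * b ^+ k) (b ^+ k * a).
  elim: k => [|k IHk]; first by left; rewrite mulg1 mul1g.
  rewrite !expgS; apply: (@ple_trans (b * a * b ^+ k)).
    by rewrite mulgA; apply: ple_mul2r.
  by rewrite -!mulgA; apply: ple_mul2l.
elim: n => [|n IHn]; first by left; rewrite mulg1.
apply: (@ple_trans (a ^+ n * b ^+ n * (a * b))); last first.
  by rewrite [_ ^+ n.+1 in X in ple _ X]expgSr; apply: ple_mul2r.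
rewrite expgSr [b ^+ n.+1]expgSr -!mulgA; apply: ple_mul2l.
by rewrite !mulgA; apply: ple_mul2r.
Qed.

Lemma ple_expMn_rl a b n :
  ple (b * a) (a * b) -> ple (b ^+ n * a ^+ n) ((a * b) ^+ n).
Proof.
move=> ba; have baX k : ple (b ^+ k * a) (a * b ^+ k).
  elim: k => [|k IHk]; first by left; rewrite mulg1 mul1g.
  rewrite !expgSr; apply: (@ple_trans (b ^+ k * (a * b))).
    by rewrite -mulgA; apply: ple_mul2l.
  by rewrite !mulgA; apply: ple_mul2r.
elim: n => [|n IHn]; first by left; rewrite mulg1.
apply: (@ple_trans (a * b * (b ^+ n * a ^+ n))); last first.
  by rewrite [(a * b) ^+ n.+1]expgS; apply: ple_mul2l.
rewrite expgS [a ^+ n.+1]expgS !mulgA; apply: ple_mul2r.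
by rewrite -expgS -[a * b * _]mulgA -expgS; apply: baX.
Qed.

Section Centraliser.
Variable c : G.

Let M : set G := [set g | commute g c]%classic.

Lemma centraliserP : subgroup M.
Proof.
apply/subgroupP; split=> [|a b ac bc|a ac]; rewrite /M /=.
- exact/commute_sym/commute1.
- by apply/commute_sym/commuteM; apply: commute_sym.
- by apply/commute_sym/commuteV/commute_sym.
Qed.

(* [gM |-> g c g^-1] identifies the [G]-set [G / M] with a conjugacy class. *)
Lemma centraliser_cone :
  relative_cone setT M [set g | plt c (g * c * g^-1)]%classic.
Proof.
split=> //= [a b ca cb|h a hc|h a hc|a _|a ca ac].
- apply: plt_trans ca _; rewrite invgM -!mulgA; apply: plt_mul2l.
  by rewrite !mulgA; apply: plt_mul2r.
- move=> /(plt_mul2l h)/(plt_mul2r h^-1); rewrite invgM !mulgA.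
  by rewrite [h * c]hc mulgK.
- by rewrite invgM !mulgA -(mulgA a h c) hc !mulgA mulgK.
- case: (plt_tri c (a * c * a^-1)) => ca; first by constructor 1.
    by constructor 2; rewrite /M /= /commute {2}ca mulgVK.
  constructor 3; move/(plt_mul2l a^-1)/(plt_mul2r a): ca.
  by rewrite !mulgA mulVg mul1g mulgVK invgK.
- by apply: (@plt_irr c); rewrite -[c in X in plt _ X](mulgK a) -ac.
Qed.

Variables (V : set G) (E : G -> int).
Hypotheses (sV : subgroup V) (Vc : V c).
Hypothesis convV : forall v p, V v -> P p -> ~ V p -> P (v * p).
Hypothesis EM : forall a b, V a -> V b -> E (a * b) = (E a + E b)%R.

(** By [convV], a positive element outside [V] stays positive after left multiplication by [V];
    conjugation invariance of [P] gives the right-hand version [VP]. *)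
Lemma convex_cone :
  relative_cone M (M `&` V)%classic (M `&` P `\` V)%classic.
Proof.
have /subgroupP[V1 VM VV] := sV; have /subgroupP[M1 MM MV] := centraliserP.
have VP v p : V v -> P p -> ~ V p -> P (p * v).
  move=> Vv Pp nVp.
  have -> : p * v = v * p ^ v by rewrite -conjgC.
  apply: convV => //; first exact: pconeJ.
  move=> Vpv; apply: nVp; have -> : p = v * p ^ v * v^-1 by rewrite -conjgC mulgK.
  by apply: (VM) => //; [apply: VM|apply: VV].
split=> [a [[]//]|a b [[Ma Pa] nVa] [[Mb Pb] nVb]|h a [Mh Vh] [[Ma Pa] nVa]| | |].
- split; first by split; [apply: MM|apply: pconeM].
  (* If [a b] were in [V], then [b^-1 = (a b)^-1 a] would be positive, as [a] is positive and
     outside [V]. *)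
  move=> Vab; have : P ((a * b)^-1 * a) by apply: convV => //; apply: VV.
  have -> : (a * b)^-1 * a = b^-1 by rewrite invgM mulgVK.
  by move=> /(pconeM posP Pb); rewrite mulgV; apply: pcone1.
- split; first by split; [apply: MM|apply: convV].
  by move=> /(VM _ _ (VV _ Vh)); rewrite mulKg.
- move=> h a [Mh Vh] [[Ma Pa] nVa]; split; first by split; [apply: MM|apply: VP].
  by move=> /VM/(_ (VV _ Vh)); rewrite mulgK.
- move=> a Ma; case: (pselect (V a)) => [Va|nVa]; first by constructor 2.
  have [Pa|a1|Pa] := pcone_tri posP a.
  + by constructor 1.
  + by case: nVa; rewrite a1.
  + constructor 3; split; first by split=> //; apply: MV.
    by move/VV; rewrite invgK.
- by move=> a [_ nVa] [].
Qed.

Let C : set G := [set expgz c k | k in setT]%classic.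

Hypothesis rootC : forall d k, expgz d k = c -> C d.
Variable n : nat.
Hypotheses (n_gt0 : 0 < n) (Ec : E c = Posz n).

(* [g] is compared with the fictitious power [c ^ (E g / n)]. *)
Lemma cyclic_cone : relative_cone (M `&` V)%classic C
  [set g | [/\ M g, V g & plt (expgz c (E g)) (g ^+ n)]]%classic.
Proof.
have /subgroupP[V1 VM VV] := sV; have /subgroupP[M1 MM MV] := centraliserP.
have CM k : M (expgz c k) by apply/commute_sym/commute_expgz.
have VC k : V (expgz c k) by apply: subgroup_expgz.
have VX a m : V a -> V (a ^+ m) by apply: (@subgroup_expgz _ _ _ m).
have E1 : E 1 = 0%R by have := EM V1 V1; rewrite mulg1; lia.
have EV a : V a -> E a^-1 = (- E a)%R.
  by move=> Va; have := EM Va (VV _ Va); rewrite mulgV E1; lia.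
have EX a m : V a -> E (a ^+ m) = (E a * Posz m)%R.
  move=> Va; elim: m => [|m IHm]; first by rewrite E1 mulr0.
  have Vm := VX a m Va; rewrite expgS EM // IHm; lia.
have EC k : E (expgz c k) = (k * Posz n)%R.
  case: k => m /=; first by rewrite EX // Ec mulrC.
  have Vm := VX c m.+1 Vc; rewrite EV // EX // Ec; lia.
have comM a k : M a -> commute a (expgz c k) by move=> Ma; apply: commute_expgz.
(* Multiplying [a] by [c ^ k] multiplies both sides by [c ^ (k n)], because [E c = n]; so the
   comparison depends only on the coset of [C]. *)
have shift k a : M a -> V a ->
    plt (expgz c (E (expgz c k * a))) ((expgz c k * a) ^+ n) <->
    plt (expgz c (E a)) (a ^+ n).
  move=> Ma Va; rewrite EM // EC expgzD expgMn; last exact/commute_sym/comM.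
  rewrite expgzM; split; last exact: plt_mul2l.
  by move/(plt_mul2l (expgz c (k * Posz n))^-1); rewrite !mulKg.
split=> [a [Ma Va _]//|a b [Ma Va lta] [Mb Vb ltb]|h a [k _ <-] [Ma Va lta]|
         h a [k _ <-] [Ma Va lta]|a [Ma Va]|a [Ma Va lta] [k _ Dk]].
- split; [exact: MM|exact: VM|rewrite EM // expgzD].
  (* [a] and [b] need not commute, but [(a b)^n] is bounded below by [a^n b^n] or by [b^n a^n],
     according to which of [a b] and [b a] is smaller. *)
  case: (ple_total (a * b) (b * a)) => ab.
    by apply: plt_le_trans (ple_expMn_lr n ab); apply: plt_mul.
  apply: plt_le_trans (ple_expMn_rl n ab).
  by rewrite -expgzD addrC expgzD; apply: plt_mul.
- by split; [exact: MM|exact: VM|apply/shift].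
- by rewrite comM //; split; [exact: MM|exact: VM|apply/shift].
- case: (plt_tri (expgz c (E a)) (a ^+ n)) => lta; first by constructor 1.
    constructor 2.
    (* The equality [a ^ n = c ^ (E a)] gives a common root [d] of [a] and [c]; it lies in [C] by
       [rootC], hence so does [a]. *)
    have [d [i [j [dc da]]]] := commute_root
      (fun g m => @pcone_torsion_free g m) Ma n_gt0 (esym lta).
    have [k _ kd] := rootC dc.
    by exists (k * j)%R => //; rewrite -expgz_mul kd.
  constructor 3; split; [exact: MV|exact: VV|].
  rewrite EV // expgzN expVgn /plt invgK; move: lta; rewrite /plt.
  have co : commute (a ^+ n) (expgz c (E a)).
    by apply: commute_expgz; apply/commute_sym/commuteX/commute_sym.
  by rewrite (commuteV (commute_sym co)).
- by move: lta; rewrite -Dk EC expgzM; apply: plt_irr.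
Qed.

End Centraliser.

(* [E] need not be compatible with the order, nor extend to a morphism on [G]. *)
Theorem maximal_cyclic_convex C :
    (forall c, c <> 1 -> exists V (E : G -> int),
      [/\ subgroup V, V c, forall v p, V v -> P p -> ~ V p -> P (v * p),
          forall a b, V a -> V b -> E (a * b) = (E a + E b)%R & E c <> 0%R]) ->
  maximal_cyclic_subgroup C -> left_relatively_convex C.
Proof.
move=> jump maxC; have sC : subgroup C.
  by have [[c ->] _] := maxC; apply: smallest_subgroupP.
have [c [DC rootC]] := maximal_cyclicP maxC.
(* If [c = 1], every [a] satisfies [a ^ 0 = c], so [C] is all of [G] and its single coset is ordered
   by the empty cone. *)
have [c1|/eqP nc1] := eqVneq c 1.
  have C1 a : C a by apply: (rootC a 0%R); rewrite c1.
  apply: (@relative_cone_convex _ _ set0) => //; split=> // a _.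
  by constructor 2.
have [V [E [sV Vc convV EM Ec0]]] := jump c nc1.
(* [E c] may be negative; the multiple of [E] by the constant [E c] takes a positive value at
   [c]. *)
have [F [n [n_gt0 FM Fc]]] : exists (F : G -> int) n, [/\ 0 < n,
    forall a b, V a -> V b -> F (a * b) = (F a + F b)%R & F c = Posz n].
  exists (fun a => E c * E a)%R, (absz (E c * E c)%R); split; [nia| |nia].
  by move=> a b Va Vb; rewrite EM // mulrDr.
rewrite DC in rootC sC *.
apply: relative_cone_convex => //.
apply: relative_cone_trans (centraliser_cone c) _ => //.
  by move=> _ [k _ <-]; apply/commute_sym/commute_expgz.
have cyc := cyclic_cone sV Vc FM rootC n_gt0 Fc.
apply: relative_cone_trans (convex_cone c sV convV) cyc => [a []//|].
move=> _ [k _ <-]; split; first by apply/commute_sym/commute_expgz.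
exact: subgroup_expgz.
Qed.

End BiOrder.

(** * Power series in noncommuting variables *)

Section Series.
Local Open Scope ring_scope.

Definition series (A : Type) := seq A -> int.
HB.instance Definition _ (A : Type) := gen_eqMixin (series A).
HB.instance Definition _ (A : Type) := gen_choiceMixin (series A).

Variable A : Type.
Implicit Types (f g h : series A) (a : A) (m : seq A).

Definition series_add f g : series A := fun m => f m + g m.
Definition series_opp f : series A := fun m => - f m.
Definition series_zero : series A := fun _ => 0.
Definition series_one : series A := fun m => if m is [::] then 1 else 0.

Fact series_addA : associative series_add.
Proof. by move=> f g h; apply/funext => m; apply: addrA. Qed.
Fact series_addC : commutative series_add.
Proof. by move=> f g; apply/funext => m; apply: addrC. Qed.
Fact series_add0 : left_id series_zero series_add.
Proof. by move=> f; apply/funext => m; apply: add0r. Qed.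
Fact series_addN : left_inverse series_zero series_opp series_add.
Proof. by move=> f; apply/funext => m; apply: addNr. Qed.
HB.instance Definition _ := GRing.isZmodule.Build (series A)
  series_addA series_addC series_add0 series_addN.

Lemma saddE f g m : (f + g) m = f m + g m. Proof. by []. Qed.
Lemma soppE f m : (- f) m = - f m. Proof. by []. Qed.
Lemma szeroE m : (0 : series A) m = 0. Proof. by []. Qed.

Definition lderiv a f : series A := fun m => f (a :: m).

(* Convolution over all factorisations of the word, by Brzozowski's rule
   [lderiv a (f g) = f [::] * lderiv a g + lderiv a f * g]. *)
Fixpoint series_mul_rec m f g : int :=
  if m is a :: m' then f [::] * g m + series_mul_rec m' (lderiv a f) g
  else f [::] * g [::].
Definition series_mul f g : series A := fun m => series_mul_rec m f g.

Let addl m f g h : series_mul_rec m (fun u => f u + g u) h =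
  series_mul_rec m f h + series_mul_rec m g h.
Proof.
elim: m f g => [|a m IHm] f g /=; rewrite mulrDl // /lderiv IHm.
by rewrite addrACA.
Qed.

Let mulDl : left_distributive series_mul +%R.
Proof. by move=> f g h; apply/funext => m; apply: addl. Qed.

Let mulDr : right_distributive series_mul +%R.
Proof.
move=> f g h; apply/funext => m; rewrite saddE /series_mul.
elim: m f => [|a m IHm] f /=; rewrite saddE mulrDr // IHm.
by rewrite addrACA.
Qed.

Let mulZl (k : int) f g m :
  series_mul_rec m (fun u => k * f u) g = k * series_mul_rec m f g.
Proof.
elim: m f => [|a m IHm] f /=; first by rewrite mulrA.
by rewrite /lderiv IHm mulrDr mulrA.
Qed.

Let mulA : associative series_mul.
Proof.
move=> f g h; apply/esym/funext => m; rewrite /series_mul.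
elim: m f g => [|a m IHm] f g /=; first by rewrite mulrA.
rewrite [series_mul_rec m (lderiv a _) h](addl m (fun u => f [::] * lderiv a g u)
  (fun u => series_mul_rec u (lderiv a f) g) h).
by rewrite mulZl IHm mulrDr !mulrA !addrA.
Qed.

Let mul0 g : series_mul 0 g = 0.
Proof.
apply/funext; rewrite /series_mul; elim=> [|a m IHm] /=; rewrite mul0r //.
by rewrite add0r; apply: IHm.
Qed.

Let mul1 : left_id series_one series_mul.
Proof.
move=> f; apply/funext; rewrite /series_mul.
case=> [|a m] /=; rewrite mul1r //.
by have /(congr1 (@^~ m)) := mul0 f; rewrite /series_mul => ->; rewrite addr0.
Qed.

Let mulr1 : right_id series_one series_mul.
Proof.
move=> f; apply/funext; rewrite /series_mul => m.
elim: m f => [|a m IHm] f /=; first by rewrite mulr1.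
by rewrite mulr0 add0r IHm.
Qed.

Let one_neq0 : series_one != 0.
Proof. by apply/eqP => /(congr1 (@^~ [::])). Qed.

HB.instance Definition _ := GRing.Zmodule_isNzRing.Build (series A)
  mulA mul1 mulr1 mulDl mulDr one_neq0.

Lemma smul_nil f g : (f * g) [::] = f [::] * g [::]. Proof. by []. Qed.

Lemma smul_cons f g a m :
  (f * g) (a :: m) = f [::] * g (a :: m) + (lderiv a f * g) m.
Proof. by []. Qed.

Lemma soneE m : (1 : series A) m = if m is [::] then 1 else 0.
Proof. by []. Qed.

End Series.

Section SeriesTheory.
Local Open Scope ring_scope.
Variable A : Type.
Implicit Types (f g h : series A) (a : A) (m : seq A) (p : pred A).

(** Only factorisations of [m] enter the coefficient at [m], and the factors of a word over [p] are
    words over [p]. *)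
Lemma smul_agree p f f' g g' :
    (forall m, all p m -> f m = f' m) -> (forall m, all p m -> g m = g' m) ->
  forall m, all p m -> (f * g) m = (f' * g') m.
Proof.
move=> ff' gg' m; elim: m f f' ff' => [|a m IHm] f f' ff' pm.
  by rewrite !smul_nil ff' ?gg'.
have /andP[pa pm'] := pm; rewrite !smul_cons ff' // gg' //; congr (_ + _).
by apply: IHm => // u pu; apply: ff'; rewrite /= pa.
Qed.

Lemma smul_agree_size n f g g' : (forall m, (size m <= n)%N -> g m = g' m) ->
  forall m, (size m <= n)%N -> (f * g) m = (f * g') m.
Proof.
move=> gg' m; elim: m f => [|a m IHm] f mn; first by rewrite !smul_nil gg'.
by rewrite !smul_cons gg' // IHm // ltnW.
Qed.

Definition vanishing k h := forall m, (size m < k)%N -> h m = 0.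

Lemma smul_vanishingl k h g m : vanishing k h -> (size m <= k)%N ->
  (h * g) m = h m * g [::].
Proof.
elim: m h k => [|a m IHm] h k hk mk; first by rewrite smul_nil.
case: k hk mk => // k hk mk; rewrite smul_cons hk // mul0r add0r.
by rewrite (IHm _ k) // => u uk; apply: hk.
Qed.

Lemma smul_vanishingr k h g m : vanishing k h -> (size m <= k)%N ->
  (g * h) m = g [::] * h m.
Proof.
case: m => [|a m] hk mk; first by rewrite smul_nil.
rewrite smul_cons (@smul_agree_size (size m) _ _ 0) ?mulr0 ?addr0 // => u um.
by rewrite hk // (leq_ltn_trans um).
Qed.

Lemma exp_vanishing h : h [::] = 0 -> forall k, vanishing k (h ^+ k).
Proof.
move=> h0; elim=> [//|k IHk] m mk; rewrite exprS.
by rewrite (smul_vanishingr _ IHk) // h0 mul0r.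
Qed.

Definition supported p f := forall m, ~~ all p m -> f m = 0.

Lemma supportedW p q f : {subset p <= q} -> supported p f -> supported q f.
Proof.
by move=> pq fp m qm; apply: fp; apply: contra qm; apply: sub_all.
Qed.

Lemma supported1 p : supported p 1. Proof. by case. Qed.

Lemma supportedD p f g : supported p f -> supported p g -> supported p (f + g).
Proof. by move=> fp gp m pm; rewrite saddE fp ?gp. Qed.

Lemma supportedN p f : supported p f -> supported p (- f).
Proof. by move=> fp m pm; rewrite soppE fp. Qed.

Lemma supportedM p f g : supported p f -> supported p g -> supported p (f * g).
Proof.
move=> + gp m; elim: m f => [//|a m IHm] f fp pm.
rewrite smul_cons gp // mulr0 add0r; move: pm; rewrite /= negb_and.
case: (boolP (p a)) => [pa|npa] /= pm.
  by apply: IHm => // u pu; apply: fp; rewrite /= pa.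
have -> : lderiv a f = 0 by apply/funext => u; apply: fp; rewrite /= (negPf npa).
by rewrite mul0r.
Qed.

Lemma supportedX p f k : supported p f -> supported p (f ^+ k).
Proof.
move=> fp; elim: k => [|k IHk]; first exact: supported1.
by rewrite exprS; apply: supportedM.
Qed.

(** The geometric series of [1 - f], cut off at exponent [size m]: when [f] has constant term 1,
    higher powers have no monomial as short as [m]. *)
Definition series_inv f : series A := fun m =>
  (\sum_(k < (size m).+1) (1 - f) ^+ k) m.

Lemma ssumE (I : Type) (r : seq I) (F : I -> series A) m :
  (\sum_(i <- r) F i) m = \sum_(i <- r) F i m.
Proof.
by elim: r => [|i r IHr]; rewrite ?big_nil ?szeroE // !big_cons saddE IHr.
Qed.

Lemma series_invE n f m : f [::] = 1 -> (size m < n)%N ->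
  series_inv f m = (\sum_(k < n) (1 - f) ^+ k) m.
Proof.
move=> f1; elim: n => // n IHn; rewrite ltnS leq_eqVlt => /predU1P[<- //|mn].
rewrite big_ord_recr /= saddE -IHn // exp_vanishing ?addr0 //.
by rewrite saddE soppE f1 soneE subrr.
Qed.

Lemma series_inv_nil f : series_inv f [::] = 1.
Proof. by rewrite /series_inv big_ord1. Qed.

Lemma series_mulrV f : f [::] = 1 -> f * series_inv f = 1.
Proof.
move=> f1; apply/funext => m; set n := (size m).+1.
rewrite (@smul_agree_size (size m) _ _ (\sum_(k < n) (1 - f) ^+ k)) //; last first.
  by move=> u um; apply: series_invE.
have -> : f * (\sum_(k < n) (1 - f) ^+ k) = 1 - (1 - f) ^+ n.
  by rewrite -[RHS]opprB subrX1 -mulNr opprB subKr.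
by rewrite saddE soppE exp_vanishing ?subr0 // saddE soppE f1 soneE subrr.
Qed.

Lemma series_mulVr f : f [::] = 1 -> series_inv f * f = 1.
Proof.
move=> f1; have := series_mulrV f1; set g := series_inv f => fg.
have gg : g * series_inv g = 1 by apply/series_mulrV/series_inv_nil.
by have -> : f = series_inv g by rewrite -[LHS]mulr1 -gg mulrA fg mul1r.
Qed.

Lemma supported_inv p f : supported p f -> supported p (series_inv f).
Proof.
move=> fp m pm; rewrite /series_inv ssumE big1 // => k _.
by apply: (supportedX _ _ pm); apply: supportedD; [exact: supported1|exact: supportedN].
Qed.

End SeriesTheory.

(** * Lowest-degree terms of series with constant term 1 *)

Section LowDegree.
Local Open Scope ring_scope.
Variable A : Type.
Implicit Types (f g : series A) (m : seq A) (k : nat).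

Definition lowdeg k f := forall m, (0 < size m < k)%N -> f m = 0.

Lemma lowdeg_vanishing k f : f [::] = 1 -> lowdeg k f -> vanishing k (f - 1).
Proof.
move=> f1 fk [|a m] mk; rewrite saddE soppE soneE; first by rewrite f1 subrr.
by rewrite fk // subr0.
Qed.

Lemma lowdegB1 f m : (0 < size m)%N -> (f - 1) m = f m.
Proof. by case: m => // a m _; rewrite saddE soppE soneE subr0. Qed.

(** Write [f g = (f - 1) g + g]. As [f - 1] starts in degree [k] or later, only the constant term of
    [g] acts on it up to degree [k]. *)
Lemma lowdegM k f g m : f [::] = 1 -> g [::] = 1 -> lowdeg k f ->
  (0 < size m <= k)%N -> (f * g) m = f m + g m.
Proof.
move=> f1 g1 fk /andP[m0 mk]; have fv := lowdeg_vanishing f1 fk.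
have -> : f * g = (f - 1) * g + g by rewrite mulrBl mul1r subrK.
by rewrite saddE (smul_vanishingl _ fv) // g1 mulr1 lowdegB1.
Qed.

Lemma lowdegV k f m : f [::] = 1 -> lowdeg k f ->
  (0 < size m <= k)%N -> series_inv f m = - f m.
Proof.
move=> f1 fk mk; have := lowdegM f1 (series_inv_nil f) fk mk.
rewrite series_mulrV //; case: m mk => // a m _; rewrite soneE => /eqP.
by rewrite eq_sym addr_eq0 => /eqP ->; rewrite opprK.
Qed.

(** Conjugation acts on [f - 1] only, and up to degree [k] only through constant terms, which are
    1. *)
Lemma lowdegJ k f g m : f [::] = 1 -> g [::] = 1 -> lowdeg k f ->
  (0 < size m <= k)%N -> (series_inv g * f * g) m = f m.
Proof.
move=> f1 g1 fk /andP[m0 mk]; have fv := lowdeg_vanishing f1 fk.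
have -> : series_inv g * f * g = series_inv g * (f - 1) * g + 1.
  by rewrite mulrBr mulr1 mulrBl series_mulVr // subrK.
have gv : vanishing k (series_inv g * (f - 1)).
  move=> u uk; rewrite (smul_vanishingr _ fv) ?(ltnW uk) //.
  by rewrite fv // mulr0.
rewrite saddE (smul_vanishingl _ gv) // g1 mulr1 (smul_vanishingr _ fv) //.
by rewrite series_inv_nil mul1r -saddE subrK.
Qed.

End LowDegree.

(** * The shift of levels and the group of twisted series *)

Section Shift.
Local Open Scope ring_scope.
Variable Z : Type.

(* [None] is the variable [T], and [Some (z, j)] is the variable [Z_(z, j)]
   attached to [z ^ (x ^+ j)]. *)
Definition letter : Type := option (Z * int).
Implicit Types (f g : series letter) (m : seq letter) (a : letter).

Definition shift_letter (k : int) a : letter :=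
  if a is Some (z, j) then Some (z, j + k) else None.

Definition shift_word k := map (shift_letter k).

Definition shift (k : int) f : series letter := fun m => f (shift_word (- k) m).

Lemma shift_word0 m : shift_word 0 m = m.
Proof.
by elim: m => //= -[[z j]|] m IHm; rewrite IHm // /shift_letter addr0.
Qed.

Lemma shift_wordD k l m : shift_word k (shift_word l m) = shift_word (k + l) m.
Proof.
elim: m => //= -[[z j]|] m IHm; rewrite IHm //= /shift_letter.
by rewrite addrAC addrA [j + k + l]addrAC.
Qed.

Lemma shift0 f : shift 0 f = f.
Proof. by apply/funext => m; rewrite /shift oppr0 shift_word0. Qed.

Lemma shiftD k l f : shift k (shift l f) = shift (k + l) f.
Proof. by apply/funext => m; rewrite /shift shift_wordD opprD addrC. Qed.

Lemma shift_nil k f : shift k f [::] = f [::]. Proof. by []. Qed.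

Lemma shiftM k f g : shift k (f * g) = shift k f * shift k g.
Proof.
apply/funext; rewrite /shift => m; elim: m f => [|a m IHm] f //=.
by rewrite !smul_cons IHm.
Qed.

Lemma shift1 k : shift k 1 = 1 :> series letter.
Proof. by apply/funext => -[]. Qed.

Lemma shiftDr k f g : shift k (f + g) = shift k f + shift k g.
Proof. by []. Qed.

(* [Twisted k f] stands for [x ^ k * f]. *)
Record twisted := Twisted {
  tw_exp : int; tw_ser : series letter; tw_nil : tw_ser [::] = 1 }.

Lemma twistedP s t : tw_exp s = tw_exp t -> tw_ser s = tw_ser t -> s = t.
Proof.
case: s t => [k f f1] [l g g1] /= kl fg; subst l g.
by congr Twisted; apply: Prop_irrelevance.
Qed.

HB.instance Definition _ := gen_eqMixin twisted.
HB.instance Definition _ := gen_choiceMixin twisted.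

Fact twisted_mul_nil s t : (shift (tw_exp t) (tw_ser s) * tw_ser t) [::] = 1.
Proof. by rewrite smul_nil shift_nil !tw_nil. Qed.

Definition twisted_one := @Twisted 0 1 erefl.
(** The rule [x^k f x^l g = x^(k+l) f^(x^l) g], conjugation by [x^l] being [shift l]. *)
Definition twisted_mul s t :=
  @Twisted (tw_exp s + tw_exp t) _ (twisted_mul_nil s t).
Definition twisted_inv s :=
  @Twisted (- tw_exp s) (shift (- tw_exp s) (series_inv (tw_ser s)))
    (series_inv_nil _).

Fact twisted_mulA : associative twisted_mul.
Proof.
move=> s t u; apply: twistedP => /=; first by rewrite addrA.
by rewrite shiftM shiftD mulrA [tw_exp t + _]addrC.
Qed.

Fact twisted_mul1 : left_id twisted_one twisted_mul.
Proof. by move=> s; apply: twistedP => /=; rewrite ?add0r ?shift1 ?mul1r. Qed.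

Fact twisted_mulr1 : right_id twisted_one twisted_mul.
Proof. by move=> s; apply: twistedP => /=; rewrite ?addr0 ?shift0 ?mulr1. Qed.

Fact twisted_mulV : left_inverse twisted_one twisted_inv twisted_mul.
Proof.
move=> s; apply: twistedP => /=; first by rewrite addNr.
by rewrite shiftD subrr shift0 series_mulVr ?tw_nil.
Qed.

Fact twisted_mulrV : right_inverse twisted_one twisted_inv twisted_mul.
Proof.
move=> s; apply: twistedP => /=; first by rewrite subrr.
by rewrite -shiftM series_mulrV ?tw_nil ?shift1.
Qed.

HB.instance Definition _ := isGroup.Build twisted
  twisted_mulA twisted_mul1 twisted_mulr1 twisted_mulV twisted_mulrV.

Lemma tw_expM s t : tw_exp (s * t)%g = tw_exp s + tw_exp t. Proof. by []. Qed.
Lemma tw_expV s : tw_exp (s^-1)%g = - tw_exp s. Proof. by []. Qed.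
Lemma tw_serM s t :
  tw_ser (s * t)%g = shift (tw_exp t) (tw_ser s) * tw_ser t.
Proof. by []. Qed.

End Shift.

(** * Morphisms out of free and presented groups *)

Section Lifts.
Local Open Scope quotient_scope.

Lemma free_lift_closed (X : Type) (H : groupType) (f : X -> H) (A : set H) a :
  subgroup A -> (forall x, A (f x)) -> A (free_lift f a).
Proof.
move=> /subgroupP[A1 AM AV] Af; rewrite /free_lift /word_eval.
elim: (repr a) => [|[b x] u IHu]; first by rewrite big_nil.
by rewrite big_cons; apply: AM => //=; case: b; [apply: AV|].
Qed.

Lemma free_lift_comp (X : Type) (H K : groupType) (f : X -> H)
    (h : UMagmaMorphism.type H K) a :
  h (free_lift f a) = free_lift (h \o f) a.
Proof.
rewrite /free_lift /word_eval; elim: (repr a) => [|[b x] u IHu].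
  by rewrite !big_nil gmulf1.
by rewrite !big_cons gmulfM IHu; case: b => //=; rewrite gmulfV.
Qed.

Lemma free_lift_id (X : Type) (a : free_group X) : free_lift (@free_gen X) a = a.
Proof.
rewrite /free_lift -[RHS]reprK; elim: (repr a) => [|[b x] u IHu].
  by rewrite /word_eval big_nil.
rewrite /word_eval big_cons -/(word_eval _ _) IHu /= -cat1s -free_mulE.
congr (_ * _); case: b => //; exact: free_invE.
Qed.

Lemma free_liftV (X : Type) (H : groupType) (f : X -> H) a :
  free_lift f a^-1 = (free_lift f a)^-1.
Proof. exact: gmulfV. Qed.

Variables (X : Type) (R : set (free_group X)) (H : groupType) (f : X -> H).

Definition pres_lift (p : presented_group R) : H := free_lift f (repr p).

Hypothesis fR : forall r, R r -> free_lift f r = 1.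

(** The kernel of the free lift is a normal subgroup containing [R], hence contains the normal
    closure, so the chosen representative does not matter. *)
Lemma pres_liftE a : pres_lift (\pi a) = free_lift f a.
Proof.
pose K : set (free_group X) := [set b | free_lift f b = 1]%classic.
have KR : normal_subgroup K /\ (R `<=` K)%classic.
  split=> //; split; last first.
    move=> g h h1; rewrite /K /= !conjgE !free_liftM free_liftV.
    by move: h1; rewrite /K /= => ->; rewrite mul1g mulVg.
  apply/subgroupP; rewrite /K; split=> /= [|b c b1 c1|b b1].
  - exact: free_lift1.
  - by rewrite free_liftM b1 c1 mulg1.
  - by rewrite free_liftV b1 invg1.
have : K ((repr (\pi_(presented_group R) a))^-1 * a) by apply: (@repr_pres _ R a K KR).
by rewrite /K /= free_liftM free_liftV => /mulg1_eq; rewrite invgK.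
Qed.

Lemma pres_liftM : {morph pres_lift : p q / p * q}.
Proof.
by move=> p q; rewrite -[p]reprK -[q]reprK [_ * _]pres_mulE !pres_liftE free_liftM.
Qed.

End Lifts.

(** * The representation by twisted power series *)

Section Representation.
Local Open Scope ring_scope.
Variables (Z : Type) (w : free_group Z).
Local Notation letter := (letter Z).
Local Notation series := (series letter).
Implicit Types (a b : letter) (f g : series) (m : seq letter).

Definition var a : series := fun m =>
  if m is [:: b] then (if `[< b = a >] then 1 else 0) else 0.

Lemma supported_var (p : pred letter) a : p a -> supported p (1 + var a).
Proof.
move=> pa; apply: supportedD; first exact: supported1.
move=> [|b [|c m]] //=; rewrite andbT => pb; case: asboolP => // ba.
by rewrite ba pa in pb.
Qed.

Definition tw_x : twisted Z := @Twisted Z 1 1 erefl.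
Definition tw_z z : twisted Z := @Twisted Z 0 (1 + var (Some (z, 0))) erefl.

Lemma untwisted_subgroup (p : pred letter) :
  subgroup [set s : twisted Z | tw_exp s = 0 /\ supported p (tw_ser s)]%classic.
Proof.
apply/subgroupP; split=> /= [|s t [s0 sp] [t0 tp]|s [s0 sp]].
- by split=> //; apply: supported1.
- by rewrite s0 t0 shift0; split; rewrite ?addr0 //; apply: supportedM.
- by rewrite s0 oppr0 shift0; split=> //; apply: supported_inv.
Qed.

Definition at_level j a := if a is Some (_, i) then i == j else false.
Definition below_level j a := if a is Some (_, i) then i < j else true.

Definition w_ser : series := tw_ser (free_lift tw_z w).

Lemma w_serP :
  tw_exp (free_lift tw_z w) = 0 /\ supported (at_level 0) w_ser.
Proof.
apply: (free_lift_closed w (untwisted_subgroup (at_level 0))) => z.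
by split=> //; apply: supported_var.
Qed.

Lemma all_shift_word (p : pred letter) k m :
  all p (shift_word k m) = all (fun a => p (shift_letter k a)) m.
Proof. exact: all_map. Qed.

(* [w_prod n] is [w_0 w_1 ... w_(n-1)], with [w_j = w ^ (x ^+ j)]; [w_limit]
   is the infinite product [w_0 w_1 w_2 ...]. *)
Fixpoint w_prod n : series :=
  if n is n'.+1 then w_prod n' * shift n' w_ser else 1.

Definition level_bound m : nat :=
  foldr (fun a n => maxn n (if a is Some (_, j) then `|j|.+1 else 0)%N) 0%N m.

Definition w_limit : series := fun m => w_prod (level_bound m) m.

Lemma w_prodS n : w_prod n.+1 = w_ser * shift 1 (w_prod n).
Proof.
elim: n => [|n IHn]; first by rewrite /= shift0 shift1 mul1r mulr1.
transitivity (w_prod n.+1 * shift n.+1 w_ser) => //.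
rewrite {1}IHn -mulrA; congr (_ * _).
by rewrite [w_prod n.+1]/= shiftM shiftD; congr (_ * shift _ _); lia.
Qed.

Lemma level_boundP (n : nat) m :
  (level_bound m <= n)%N -> all (below_level n) m.
Proof.
elim: m => //= a m IHm; rewrite geq_max => /andP[/IHm -> an].
by rewrite andbT; case: a an => [[z j]|] //= jn; lia.
Qed.

(** Each extra factor [w_j], with [j >= n], is 1 plus words in letters of level [j], which cannot
    occur in a word below level [n]. *)
Lemma w_prod_stable (n n' : nat) m : (n <= n')%N -> all (below_level n) m ->
  w_prod n' m = w_prod n m.
Proof.
move=> nn' mn; rewrite -(subnKC nn'); elim: (n' - n)%N => [|k IHk].
  by rewrite addn0.
rewrite addnS -IHk -[RHS](congr1 (@^~ m) (mulr1 (w_prod (n + k)))).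
have mk : all (below_level (n + k)%N) m.
  by apply: sub_all mn => -[[z j]|] //=; lia.
apply: smul_agree mk => // -[|a u]; rewrite /shift /=.
  by move=> _; apply: tw_nil.
move=> /andP[ak _]; apply: w_serP.2; rewrite /= negb_and.
by case: a ak => [[z j]|] //=; lia.
Qed.

Lemma w_limitE (n : nat) m : all (below_level n) m -> w_limit m = w_prod n m.
Proof.
move=> mn; have mb := level_boundP (leqnn (level_bound m)).
rewrite -(w_prod_stable (leq_maxl n (level_bound m)) mn).
exact/esym/(w_prod_stable (leq_maxr n (level_bound m)) mb).
Qed.

Lemma w_limit_nil : w_limit [::] = 1. Proof. by []. Qed.

Lemma w_limit_shift : w_limit = w_ser * shift 1 w_limit.
Proof.
apply/funext => m; pose n := level_bound m.
have mn : all (below_level n) m by apply: level_boundP.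
rewrite (@w_limitE n.+1); last by apply: sub_all mn => -[[z j]|] //=; lia.
rewrite w_prodS; apply: smul_agree mn => // u un; rewrite /shift.
apply/esym/w_limitE; rewrite all_shift_word; apply: sub_all un.
by move=> [[z j]|] //=; lia.
Qed.

Lemma supported_w_limit : supported (fun a => ~~ below_level 0 a) w_limit.
Proof.
move=> m; rewrite (@w_limitE (level_bound m)); last exact: level_boundP.
apply: (_ : supported _ _); elim: (level_bound m) => [|n IHn] /=.
  exact: supported1.
apply: supportedM => // u un; apply: w_serP.2; apply: contra un.
rewrite all_shift_word; apply: sub_all => -[[z j]|] //=; lia.
Qed.

Fact tw_y_nil : ((1 + var None) * series_inv w_limit) [::] = 1.
Proof. by rewrite smul_nil series_inv_nil mulr1. Qed.

Definition tw_y : twisted Z := @Twisted Z 0 _ tw_y_nil.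

Definition tw_gen (s : xyZ Z) : twisted Z :=
  match s with sym_x => tw_x | sym_y => tw_y | sym_Z z => tw_z z end.

Lemma shift_var_None k : shift k (var None) = var None.
Proof.
apply/funext => -[|[[z j]|] [|b m]] //; rewrite /shift /=.
by case: asboolP => //; case: asboolP.
Qed.

(** Conjugation by [x] is the shift, which fixes [1 + T]. Writing [W] for [w_limit], the identity
    [W = w_ser * shift 1 W] gives [shift 1 W^-1 = W^-1 * w_ser]. *)
Lemma tw_yx : (tw_y * tw_x = tw_x * (tw_y * free_lift tw_z w))%g.
Proof.
have [w0 _] := w_serP; apply: twistedP => /=; first by rewrite w0; lia.
rewrite w0 !shift0 mulr1 mul1r shiftM shiftDr shift1 shift_var_None.
rewrite -mulrA -/w_ser; congr (_ * _).
have Q1 : shift 1 (series_inv w_limit) * shift 1 w_limit = 1.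
  by rewrite -shiftM series_mulVr ?shift1.
have Q2 : shift 1 w_limit * shift 1 (series_inv w_limit) = 1.
  by rewrite -shiftM series_mulrV ?shift1.
have Q3 : series_inv w_limit * w_ser * shift 1 w_limit = 1.
  by rewrite -mulrA -w_limit_shift series_mulVr.
by rewrite -[RHS]mulr1 -Q2 mulrA Q3 mul1r.
Qed.

Lemma tw_relator : free_lift tw_gen (xy_relator w) = 1%g.
Proof.
rewrite /xy_relator free_liftM free_lift_comp.
have -> : (free_lift tw_gen \o (fun z => free_gen (sym_Z z))) = tw_z.
  by apply/funext => z; rewrite /= free_lift_gen.
rewrite commgEl conjgE !free_liftM !free_liftV !free_lift_gen /=.
set W := free_lift tw_z w; transitivity ((tw_y * tw_x)^-1 * (tw_x * (tw_y * W)))%g.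
  by rewrite invgM !mulgA.
by rewrite [in X in (X^-1 * _)%g]tw_yx mulVg.
Qed.

End Representation.

(** * Faithfulness *)

Section Faithful.
Local Open Scope quotient_scope.
Variables (Z : Type) (w : free_group Z).
Local Notation G := (xy_group w).
Local Notation letter := (letter Z).
Local Notation piG := (\pi_(presented_group [set xy_relator w]%classic)).
Implicit Types (a b : letter) (m : seq letter) (g h : G).

Definition xy_rep : G -> twisted Z := pres_lift (tw_gen w).

Definition xy_pi (p : free_group (xyZ Z)) : G := piG p.

Lemma xy_piM : {morph xy_pi : p q / p * q}.
Proof. by move=> p q; apply/esym/pres_mulE. Qed.

HB.instance Definition _ :=
  isUMagmaMorphism.Build (free_group (xyZ Z)) G xy_pi (erefl, xy_piM).

Lemma xy_repE (p : free_group (xyZ Z)) : xy_rep (xy_pi p) = free_lift (tw_gen w) p.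
Proof. by apply: pres_liftE => r ->; apply: tw_relator. Qed.

Lemma xy_repM : {morph xy_rep : g h / g * h}.
Proof. by apply: pres_liftM => r ->; apply: tw_relator. Qed.

Lemma xy_rep1 : xy_rep 1 = 1.
Proof. by rewrite -[LHS]/(xy_rep (xy_pi 1)) xy_repE free_lift1. Qed.

HB.instance Definition _ :=
  isUMagmaMorphism.Build G (twisted Z) xy_rep (xy_rep1, xy_repM).

Lemma xy_repV g : xy_rep g^-1 = (xy_rep g)^-1. Proof. exact: gmulfV. Qed.
Lemma xy_repJ g h : xy_rep (g ^ h) = xy_rep g ^ xy_rep h. Proof. exact: gmulfJ. Qed.
Lemma xy_repX g k : xy_rep (expgz g k) = expgz (xy_rep g) k.
Proof. exact: gmulf_expgz. Qed.

Definition gen (s : xyZ Z) : G := xy_pi (free_gen s).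
Local Notation x := (gen sym_x).
Local Notation y := (gen sym_y).

Lemma xy_rep_gen s : xy_rep (gen s) = tw_gen w s.
Proof. by rewrite xy_repE free_lift_gen. Qed.

Lemma xy_group_ind (H : set G) :
  subgroup H -> (forall s, H (gen s)) -> forall g, H g.
Proof.
move=> sH Hgen g; rewrite -[g]reprK -/(xy_pi _) -[repr g]free_lift_id.
by rewrite free_lift_comp; apply: free_lift_closed.
Qed.

Lemma xy_relation : y * x = x * (y * free_lift (fun z => gen (sym_Z z)) w).
Proof.
have : xy_pi (xy_relator w) = 1.
  apply/esym/pres_piP; rewrite invg1 mul1g => H [_]; exact.
rewrite /xy_relator gmulfM gmulfR free_lift_comp => /(congr1 (fun g => y * x * g)).
by rewrite mulg1 => <-; rewrite mulgA -commgC mulgA.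
Qed.

(** [T] is matched with [y]: on words in letters below level 0 the series of [y] agrees with
    [1 + T]. *)
Definition letter_elt a : G :=
  if a is Some (z, j) then gen (sym_Z z) ^ expgz x j else y.

Lemma tw_xX k : expgz (tw_x Z) k = @Twisted Z k 1%R erefl.
Proof.
have sub1 : subgroup [set s : twisted Z | tw_ser s = 1%R]%classic.
  apply/subgroupP; split=> //= s => [t s1 t1|s1]; first by rewrite s1 t1 shift1 mulr1.
  by rewrite s1 -[series_inv 1%R]mul1r series_mulrV ?shift1.
apply: twistedP; last exact: (subgroup_expgz k sub1).
have expX n : tw_exp (tw_x Z ^+ n) = n.
  by elim: n => // n IHn; rewrite expgS tw_expM IHn /=; lia.
by case: k => n /=; rewrite expX //; lia.
Qed.

Lemma tw_conj_xX (s : twisted Z) k : tw_exp s = 0%R ->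
  s ^ expgz (tw_x Z) k = @Twisted Z 0%R (shift k (tw_ser s)) (tw_nil s).
Proof.
move=> s0; rewrite conjgE; apply: (mulgI (expgz (tw_x Z) k)); rewrite mulVKg.
rewrite tw_xX; apply: twistedP; rewrite /= ?s0 ?add0r ?addr0 //.
by rewrite mulr1 shift1 mul1r.
Qed.

Lemma shift_var k (z : Z) j : shift k (var (Some (z, j))) = var (Some (z, (j + k)%R)).
Proof.
apply/funext => -[|[[u i]|] [|b m]] //; rewrite /shift /=.
  case: asboolP => [[-> ik]|ne]; case: asboolP => // e.
    by case: e; congr (Some (_, _)); lia.
  by case: e => uz ij; case: ne; rewrite uz ij; congr (Some (_, _)); lia.
by case: asboolP => //; case: asboolP.
Qed.

Lemma xy_rep_letter z j : xy_rep (letter_elt (Some (z, j))) =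
  @Twisted Z 0%R (1 + var (Some (z, j)))%R erefl.
Proof.
rewrite /= xy_repJ xy_repX !xy_rep_gen tw_conj_xX //; apply: twistedP => //=.
by rewrite shiftDr shift1 shift_var add0r.
Qed.

Definition below : set G :=
  smallest (@subgroup G) [set letter_elt a | a in below_level 0%R]%classic.

Lemma below_subgroup : subgroup below. Proof. exact: smallest_subgroupP. Qed.

Lemma below_letter a : below_level 0%R a -> below (letter_elt a).
Proof. by move=> a0 H [_ AH]; apply: AH; exists a. Qed.

Lemma below_ind (H : set G) : subgroup H ->
  (forall a, below_level 0%R a -> H (letter_elt a)) -> forall g, below g -> H g.
Proof.
by move=> sH Ha g bg; apply: (bg H); split=> // _ [a a0 <-]; apply: Ha.
Qed.

(** Conjugation by [x^-1] lowers every level by one, and the relation [y ^ x = y W] gives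
    [y ^ x^-1 = y (W ^ x^-1)^-1], where [W ^ x^-1] is a word in elements of level -1. *)
Lemma below_conj g : below g -> below (g ^ x^-1).
Proof.
move: g; apply: (@below_ind [set g | below (g ^ x^-1)]%classic).
  exact/subgroupJ/below_subgroup.
move=> [[z j]|] a0 /=.
  rewrite -conjgM -[x^-1]/(expgz x (-1)%R) -expgzD.
  by apply: (@below_letter (Some (z, (j + -1)%R))); rewrite /=; move: a0 => /=; lia.
pose W := free_lift (fun z => gen (sym_Z z)) w.
have -> : y ^ x^-1 = y * (W ^ x^-1)^-1.
  by rewrite !conjgE !invgM !invgK !mulgA xy_relation -/W !mulgA mulgK.
have [_ BM BV] := (subgroupP below).1 below_subgroup.
apply: BM; first exact: (@below_letter None).
apply: BV; rewrite /W.
apply: (@free_lift_closed _ _ _ [set g | below (g ^ x^-1)]%classic) => [|z].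
  exact/subgroupJ/below_subgroup.
exact: (@below_letter (Some (z, (-1)%R))).
Qed.

(** By [below_conj], the conjugates of [below] by [x ^+ n] increase with [n], so their union is
    again a subgroup, and it is stable under conjugation by every power of [x]. *)
Definition below_conjugates : set G :=
  [set g | exists n, below (g ^ (x ^- n))]%classic.

Lemma below_conjX g (m n : nat) :
  below (g ^ (x ^- m)) -> m <= n -> below (g ^ (x ^- n)).
Proof.
move=> bg /subnKC <-; elim: (n - m) => [|k IHk]; first by rewrite addn0.
by rewrite addnS expgS invgM conjgM; apply: below_conj.
Qed.

Lemma below_conjugates_subgroup : subgroup below_conjugates.
Proof.
have [B1 BM BV] := (subgroupP below).1 below_subgroup.
apply/subgroupP; split=> [|a b [m am] [n bn]|a [n an]].
- by exists 0; rewrite conj1g.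
- exists (maxn m n); rewrite conjMg.
  by apply: BM; [apply: below_conjX am _|apply: below_conjX bn _];
    rewrite ?leq_maxl ?leq_maxr.
- by exists n; rewrite conjVg; apply: BV.
Qed.

Lemma below_conjugatesJ g k :
  below_conjugates g -> below_conjugates (g ^ expgz x k).
Proof.
move=> [n bn]; case: k => k /=.
  by exists (n + k)%N; rewrite -conjgM expgnDr invgM mulgA mulgV mul1g.
exists n; rewrite -conjgM -invgM -expgnDr; apply: below_conjX bn _.
exact: leq_addr.
Qed.

Lemma below_decomposition g :
  exists n k h, below h /\ g = h ^ (x ^+ n) * expgz x k.
Proof.
have [K1 KM KV] := (subgroupP _).1 below_conjugates_subgroup.
suff [h [k [[n bn] ->]]] : exists h k, below_conjugates h /\ g = h * expgz x k.
  by exists n, k, (h ^ (x ^- n)); rewrite -conjgM mulVg conjg1.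
move: g; apply: (@xy_group_ind [set g | _]%classic); last first.
  have gen_below a : below_level 0%R a -> below_conjugates (letter_elt a).
    by move=> a0; exists 0; rewrite invg1 conjg1; apply: below_letter.
  move=> [||z].
  - by exists 1, 1%R; rewrite mul1g.
  - by exists y, 0%R; rewrite mulg1; split=> //; apply: (gen_below None).
  - exists (gen (sym_Z z)), 0%R; rewrite mulg1; split=> //.
    (* [z] has level 0, so it is not among the generators of [below]; it is the conjugate by [x] of
       [z ^ x^-1], of level -1. *)
    have := below_conjugatesJ 1%R (gen_below (Some (z, (-1)%R)) isT).
    by rewrite /= -conjgM mulVg conjg1.
apply/subgroupP; split=> [|a b [h [k [Kh ->]]] [h' [k' [Kh' ->]]]|a [h [k [Kh ->]]]].
- by exists 1, 0%R; rewrite mulg1.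
- exists (h * h' ^ (expgz x (- k)%R)), (k + k')%R.
  split; first by apply: KM => //; apply: below_conjugatesJ.
  by rewrite expgzD expgzN conjgE invgK -!mulgA mulKg.
- exists (h^-1 ^ expgz x k), (- k)%R.
  split; first by apply/below_conjugatesJ/KV.
  by rewrite invgM expgzN conjgE -!mulgA mulgV mulg1.
Qed.

End Faithful.

(** * Magnus' argument on reduced products *)

Section Injectivity.
Local Open Scope ring_scope.
Variables (Z : Type) (w : free_group Z).
Local Notation G := (xy_group w).
Local Notation letter := (letter Z).
Local Notation low := (@below_level Z 0).
Implicit Types (a b : letter) (m : seq letter) (g h : G) (l : seq (letter * int)).

Definition syllables l : G := \prod_(s <- l) expgz (letter_elt w s.1) s.2.

Fixpoint reduced l : Prop :=
  if l is (a, e) :: l' then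
    [/\ low a, e <> 0, (if l' is (b, _) :: _ then a <> b else True) & reduced l']
  else True.

Lemma reduced_tail a e l : reduced ((a, e) :: l) -> reduced l.
Proof. by case. Qed.

(** Left multiplication by a power of a letter preserves the reduced products: the power is
    prepended, merges with the first syllable or cancels it. *)
Lemma below_reduced g : below g -> exists l, reduced l /\ g = syllables l.
Proof.
pose N : set G := [set g | exists l, reduced l /\ g = syllables l]%classic.
have N1 : N 1%g by exists [::]; rewrite /syllables big_nil.
have NX a e h : low a -> N h -> N (expgz (letter_elt w a) e * h)%g.
  move=> a0 [l [rl ->]]; have [->|/eqP e0] := eqVneq e 0.
    by rewrite mul1g; exists l.
  case: l rl => [|[b e'] l] rl.
    by exists [:: (a, e)]; rewrite /syllables !big_cons.
  case: (pselect (a = b)) => [ab|ab]; last first.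
    by exists [:: (a, e), (b, e') & l]; rewrite /syllables [in RHS]big_cons.
  subst b; rewrite /syllables big_cons /= mulgA -expgzD.
  have [->|/eqP ee'] := eqVneq (e + e') 0.
    by rewrite mul1g; exists l; split=> //; apply: reduced_tail rl.
  exists ((a, e + e') :: l); split; last by rewrite /syllables big_cons.
  by case: rl.
(* The elements that preserve [N] under left multiplication, together with their inverses, form a
   subgroup; so only letters need checking. *)
suff sub k : below k ->
    (forall h, N h -> N (k * h)%g) /\ (forall h, N h -> N (k^-1 * h)%g).
  by move=> bg; have [/(_ _ N1)] := sub g bg; rewrite mulg1.
move: k; apply: (@below_ind _ _ [set g | _ /\ _]%classic) => [|a a0] /=.
  apply/subgroupP; split=> [|a b [A A'] [B B']|a [A A']] /=.
  - by split=> h; rewrite ?invg1 mul1g.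
  - by split=> h Nh; rewrite ?invgM -mulgA; [apply/A/B|apply/B'/A'].
  - by rewrite invgK.
by split=> h; [apply: (NX a 1)|apply: (NX a (-1))].
Qed.

(** Among words in low letters, a series supported here sees only powers of [a]. *)
Definition eq_or_nonneg a : pred letter := fun b => `[< b = a >] || ~~ low b.

Lemma xy_rep_letter_supported a : low a ->
  tw_exp (xy_rep (letter_elt w a)) = 0 /\
  supported (eq_or_nonneg a) (tw_ser (xy_rep (letter_elt w a))).
Proof.
case: a => [[z j]|] a0.
  rewrite xy_rep_letter; split=> //; apply: supported_var.
  by rewrite /eq_or_nonneg; case: asboolP.
rewrite [letter_elt w None]/= xy_rep_gen; split=> //=; apply: supportedM.
  by apply: supported_var; rewrite /eq_or_nonneg; case: asboolP.
apply: supported_inv; apply: supportedW (supported_w_limit w) => b.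
by rewrite !unfold_in /eq_or_nonneg => ->; rewrite orbT.
Qed.

Lemma xy_rep_letter_coef a : low a -> tw_ser (xy_rep (letter_elt w a)) [:: a] = 1.
Proof.
case: a => [[z j]|] a0.
  by rewrite xy_rep_letter /= saddE soneE /var; case: asboolP.
rewrite [letter_elt w None]/= xy_rep_gen /=.
(* Degree-one coefficients are additive, and [w_limit] has coefficient 0 at [T]. *)
rewrite (@lowdegM _ 1) ?series_inv_nil ?w_limit_nil //; last by case=> // b [|].
rewrite (@lowdegV _ 1) ?w_limit_nil //; last by case=> // b [|].
rewrite (supported_w_limit w) // subr0 saddE soneE /var.
by case: asboolP.
Qed.

Lemma xy_rep_power a e (f := tw_ser (xy_rep (expgz (letter_elt w a) e))) : low a ->
  [/\ tw_exp (xy_rep (expgz (letter_elt w a) e)) = 0,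
      supported (eq_or_nonneg a) f & f [:: a] = e].
Proof.
move=> a0; rewrite {}/f xy_repX; set s := xy_rep _.
have [s0 sp] := xy_rep_letter_supported a0; have s1 := xy_rep_letter_coef a0.
have [] := subgroup_expgz e (untwisted_subgroup (eq_or_nonneg a)) (conj s0 sp).
rewrite -/s => e0 ep; split=> //.
have one_coef t u : tw_exp u = 0 ->
    tw_ser (t * u)%g [:: a] = tw_ser t [:: a] + tw_ser u [:: a].
  move=> u0; rewrite tw_serM u0 shift0 (@lowdegM _ 1) ?tw_nil //.
  by case=> // b [|].
have expX n : tw_exp (s ^+ n)%g = 0.
  by elim: n => // n IHn; rewrite expgS tw_expM IHn s0.
have serX n : tw_ser (s ^+ n)%g [:: a] = n.
  elim: n => // n IHn; rewrite expgS one_coef // IHn s1; lia.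
case: e {e0 ep} => n; first exact: serX.
have := one_coef (s ^+ n.+1)%g (s ^- n.+1)%g.
rewrite mulgV tw_expV expX serX oppr0 => /(_ erefl).
rewrite [expgz _ _]/(s ^- n.+1)%g -[tw_ser 1%g _]/0.
by set c := tw_ser _ _; lia.
Qed.

Fixpoint alternating m : Prop :=
  if m is a :: m' then
    (if m' is b :: _ then a <> b else True) /\ alternating m'
  else True.

Section Power.
Variables (a : letter) (f g : series letter) (e : int).
Hypotheses (f1 : f [::] = 1) (fa : supported (eq_or_nonneg a) f) (fe : f [:: a] = e).

(** On an alternating word of low letters, [f] can be nonzero only at the empty prefix and at the
    prefix [a], so multiplication by [f] strips at most one letter. The two lemmas separate the
    possible first letters. *)
Lemma power_mul_neq b m : low b -> b <> a -> (f * g) (b :: m) = g (b :: m).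
Proof.
move=> b0 ba; rewrite smul_cons f1 mul1r.
have -> : lderiv b f = 0; last by rewrite mul0r addr0.
apply/funext => u; apply: fa; rewrite /= /eq_or_nonneg b0 orbF.
by case: asboolP.
Qed.

Lemma power_mul_eq m : alternating (a :: m) -> all low m ->
  (f * g) (a :: m) = g (a :: m) + e * g m.
Proof.
rewrite smul_cons f1 mul1r => -[am _] m0; congr (_ + _).
case: m am m0 => [|b m] ab /=; first by rewrite smul_nil /lderiv fe.
case/andP=> b0 _; rewrite smul_cons [lderiv a f [::]]fe.
have -> : lderiv b (lderiv a f) = 0; last by rewrite mul0r addr0.
apply/funext => u; apply: fa; rewrite /= /eq_or_nonneg b0 orbF negb_and.
by rewrite orbC; case: asboolP => // /esym.
Qed.

End Power.

Lemma syllables_cons a e l : syllables ((a, e) :: l) =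
  (expgz (letter_elt w a) e * syllables l)%g.
Proof. by rewrite /syllables big_cons. Qed.

Lemma xy_rep_syllables_exp l : reduced l -> tw_exp (xy_rep (syllables l)) = 0.
Proof.
elim: l => [|[a e] l IHl]; first by rewrite /syllables big_nil xy_rep1.
case=> a0 _ _ rl; rewrite syllables_cons xy_repM tw_expM IHl //.
by have [-> _ _] := xy_rep_power e a0.
Qed.

(** Each syllable strips at most one letter, so a word longer than the list of syllables is never
    exhausted. *)
Lemma xy_rep_syllables_long l m : reduced l -> alternating m -> all low m ->
  (size l < size m)%N -> tw_ser (xy_rep (syllables l)) m = 0.
Proof.
elim: l m => [|[a e] l IHl] m; first by rewrite /syllables big_nil xy_rep1; case: m.
move=> [a0 e0 _ rl] am m0 lm; rewrite syllables_cons xy_repM tw_serM.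
rewrite xy_rep_syllables_exp // shift0; have [_ fa fe] := xy_rep_power e a0.
case: m am m0 lm => [//|b m] am m0; rewrite /= ltnS => lm.
have [b0 m0'] := andP m0.
case: (pselect (b = a)) => [ba|ba].
  rewrite ba in am m0 *; rewrite (power_mul_eq _ _ fa fe) ?tw_nil //.
  by rewrite !IHl ?mulr0 //; [case: am|apply: ltnW].
by rewrite (power_mul_neq _ _ fa) ?tw_nil // IHl // ltnW.
Qed.

(** To exhaust this word every syllable must strip its own letter, contributing its exponent; the
    term in which the first one strips nothing vanishes by [xy_rep_syllables_long]. *)
Lemma xy_rep_syllables_coef l : reduced l ->
  tw_ser (xy_rep (syllables l)) (map fst l) = \prod_(s <- l) s.2.
Proof.
have alt k : reduced k -> alternating (map fst k) /\ all low (map fst k).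
  elim: k => //= -[a e] k IHk [a0 _ ak /IHk[Ak ->]]; rewrite a0; split=> //.
  by split=> //; case: k ak {IHk Ak} => // -[].
elim: l => [|[a e] l IHl]; first by rewrite /syllables !big_nil xy_rep1.
move=> rl; have [a0 e0 _ rl'] := rl; have [al l0] := alt _ rl.
have [al' l0'] := alt _ rl'.
rewrite syllables_cons xy_repM tw_serM xy_rep_syllables_exp // shift0.
have [_ fa fe] := xy_rep_power e a0.
rewrite [map _ _]/= (power_mul_eq _ _ fa fe) ?tw_nil // IHl // big_cons.
by rewrite xy_rep_syllables_long ?add0r //= size_map.
Qed.

Theorem xy_rep_inj g : xy_rep g = 1%g -> g = 1%g.
Proof.
have [n [k [h [bh ->]]]] := below_decomposition g.
have [l [rl hl]] := below_reduced bh.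
rewrite xy_repM xy_repJ xy_repX xy_rep_gen => rg.
(* Reduced products have exponent 0, so [k] is the [x]-exponent of the image. *)
have k0 : k = 0.
  have := congr1 (@tw_exp Z) rg; rewrite conjgE !tw_expM tw_expV hl.
  by rewrite xy_rep_syllables_exp // tw_xX /=; lia.
move: rg; rewrite k0 mulg1 => /eqP; rewrite conjg_eq1 hl => /eqP r1.
rewrite mulg1; case: l rl r1 {hl} => [|s l] rl r1.
  by rewrite /syllables big_nil conj1g.
(* The series 1 has coefficient 0 at the nonempty word of letters, whereas this coefficient is a
   product of nonzero exponents. *)
have /esym/eqP := xy_rep_syllables_coef rl; rewrite r1 big_cons.
have nz k' : reduced k' -> \prod_(s <- k') s.2 != 0.
  elim: k' => [|[a e] k' IHk] /=; first by rewrite big_nil.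
  by case=> _ /eqP e0 _ /IHk; rewrite big_cons; apply: mulf_neq0.
by have := nz _ rl; rewrite big_cons => /negPf ->.
Qed.

End Injectivity.

(** * The bi-order *)

Section WordOrder.
Local Open Scope ring_scope.

Lemma strict_well_order (T : Type) : exists lt : T -> T -> Prop,
  [/\ forall a b c, lt a b -> lt b c -> lt a c,
      forall a b, [\/ lt a b, a = b | lt b a] &
      forall A : T -> Prop, (exists a, A a) ->
        exists2 a, A a & forall b, lt b a -> ~ A b].
Proof.
have [R woR] := well_ordering_principle {classic T}.
have minR (A : T -> Prop) : (exists a, A a) ->
    exists2 a, A a & forall b, A b -> R a b.
  move=> [a Aa]; have [|z [[Az lbz] _]] := woR (fun b => `[< A b >]).
    by exists a; apply/asboolP.
  exists z; first exact/asboolP.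
  by move=> b Ab; apply: lbz; apply/asboolP.
have wR : wo_chain R predT := withinW woR.
have anti a b : R a b -> R b a -> a = b.
  by move=> ab ba; apply: (wo_chain_antisymmetric wR); rewrite ?ab.
exists (fun a b => R a b /\ a <> b); split=> [a b c [ab nab] [bc nbc]|a b|A exA].
- split; last by move=> ac; apply: nab; apply: anti => //; rewrite ac.
  (* Transitivity is read off from the least element of the set formed by [a], [b] and [c]. *)
  have [|z zE zmin] := minR (fun t => [\/ t = a, t = b | t = c]).
    by exists a; constructor 1.
  case: zE => zE; rewrite zE in zmin.
  + by apply: zmin; constructor 3.
  + by case: nab; apply: anti => //; apply: zmin; constructor 1.
  + by case: nbc; apply: anti => //; apply: zmin; constructor 2.
- case: (pselect (a = b)) => [|nab]; first by constructor 2.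
  have /orP[ab|ba] := wo_chainW wR (isT : a \in predT) (isT : b \in predT).
    by constructor 1.
  by constructor 3; split=> // ba'; apply: nab.
- have [a Aa amin] := minR A exA; exists a => // b [ba nba] Ab.
  by apply: nba; apply: anti => //; apply: amin.
Qed.

End WordOrder.

(** * Ordering of monomials and signs of leading coefficients *)

Section SeriesOrder.
Local Open Scope ring_scope.
Variables (Z : Type) (zlt : Z -> Z -> Prop).
Hypotheses (zlt_trans : forall a b c, zlt a b -> zlt b c -> zlt a c)
  (zlt_tri : forall a b, [\/ zlt a b, a = b | zlt b a])
  (zlt_min : forall A : Z -> Prop, (exists a, A a) ->
     exists2 a, A a & forall b, zlt b a -> ~ A b).
Local Notation letter := (letter Z).
Implicit Types (a b c : letter) (m u : seq letter) (f g : series letter).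

Definition letter_lt a b : Prop :=
  match a, b with
  | None, Some _ => True
  | Some (z, i), Some (z', j) => i < j \/ i = j /\ zlt z z'
  | _, _ => False
  end.

Lemma letter_lt_trans a b c : letter_lt a b -> letter_lt b c -> letter_lt a c.
Proof.
case: a b c => [[z i]|] [[z' j]|] [[z'' k]|] //= [ij|[-> zz']] [jk|[<- zz'']].
- by left; lia.
- by left.
- by left.
- by right; split=> //; apply: zlt_trans zz''.
Qed.

Lemma letter_lt_tri a b : [\/ letter_lt a b, a = b | letter_lt b a].
Proof.
case: a b => [[z i]|] [[z' j]|] /=;
  [|by constructor 3|by constructor 1|by constructor 2].
case: (ltgtP i j) => [ij|ji|->]; [by constructor 1; left|by constructor 3; left|].
case: (zlt_tri z z') => [zz'|->|zz']; [constructor 1|constructor 2|constructor 3] => //.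
  by right.
by right.
Qed.

Lemma letter_lt_shift k a b :
  letter_lt a b -> letter_lt (shift_letter k a) (shift_letter k b).
Proof.
case: a b => [[z i]|] [[z' j]|] //= [ij|[-> zz']]; [left; lia|by right].
Qed.

Definition above_level (N : int) : pred letter :=
  fun a => if a is Some (_, j) then - N <= j else true.

(** Levels are unbounded below in general; under the bound [N] a least level exists, and [zlt] then
    selects a least letter on it. *)
Lemma letter_lt_min N (A : letter -> Prop) :
    (forall a, A a -> above_level N a) -> (exists a, A a) ->
  exists2 a, A a & forall b, letter_lt b a -> ~ A b.
Proof.
move=> AN exA; case: (pselect (A None)) => [A0|nA0].
  by exists None => // -[[z j]|].
pose lev n := `[< exists z, A (Some (z, n%:Z - N)) >].
have exlev : exists n, lev n.
  have [[[z j]|] Aa] := exA; last by case: nA0.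
  exists (absz (j + N)); apply/asboolP; exists z; have /= := AN _ Aa => jN.
  by have -> : (absz (j + N))%:Z - N = j by lia.
have [n /asboolP exz nmin] := ex_minnP exlev.
have [z Az zmin] := zlt_min exz; exists (Some (z, n%:Z - N)) => //.
move=> [[z' j]|] //= [jn|[-> /zmin //]] Ab; have /= jN := AN _ Ab.
have : (n <= absz (j + N)%R)%N.
  by apply: nmin; apply/asboolP; exists z'; have -> : (absz (j + N))%:Z - N = j by lia.
by lia.
Qed.

Fixpoint lex_lt m u : Prop :=
  match m, u with
  | a :: m', b :: u' => letter_lt a b \/ a = b /\ lex_lt m' u'
  | _, _ => False
  end.

Definition word_lt m u : Prop :=
  (size m < size u)%N \/ size m = size u /\ lex_lt m u.

Lemma lex_lt_trans m u v : lex_lt m u -> lex_lt u v -> lex_lt m v.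
Proof.
elim: m u v => [|a m IHm] [|b u] [|c v] //= [ab|[-> mu]] [bc|[<- uv]].
- by left; apply: letter_lt_trans bc.
- by left.
- by left.
- by right; split=> //; apply: IHm uv.
Qed.

Lemma word_lt_trans m u v : word_lt m u -> word_lt u v -> word_lt m v.
Proof.
move=> [mu|[mu lmu]] [uv|[uv luv]].
- by left; apply: ltn_trans uv.
- by left; rewrite -uv.
- by left; rewrite mu.
- by right; rewrite mu; split=> //; apply: lex_lt_trans luv.
Qed.

Lemma lex_lt_tri m u : size m = size u -> [\/ lex_lt m u, m = u | lex_lt u m].
Proof.
elim: m u => [|a m IHm] [|b u] //=; first by constructor 2.
case=> /IHm mu; case: (letter_lt_tri a b) => [ab|->|ba].
- by constructor 1; left.
- by case: mu => [mu|->|um]; [constructor 1; right|constructor 2|constructor 3; right].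
- by constructor 3; left.
Qed.

Lemma word_lt_tri m u : [\/ word_lt m u, m = u | word_lt u m].
Proof.
case: (ltngtP (size m) (size u)) => [mu|um|mu].
- by constructor 1; left.
- by constructor 3; left.
case: (lex_lt_tri mu) => lmu; [constructor 1|constructor 2|constructor 3] => //.
  by right.
by right.
Qed.

Lemma word_lt_shift k m u :
  word_lt m u -> word_lt (shift_word k m) (shift_word k u).
Proof.
rewrite /word_lt !size_map => -[|[mu lmu]]; [by left|right; split=> //].
elim: m u lmu {mu} => [|a m IHm] [|b u] //= [ab|[-> /IHm]]; last by right.
by left; apply: letter_lt_shift.
Qed.

(** Take the least possible first letter, then recurse on the tails that follow it. *)
Lemma lex_lt_min N n (A : seq letter -> Prop) :
    (forall m, A m -> all (above_level N) m) ->
    (exists2 m, size m = n & A m) ->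
  exists m, [/\ size m = n, A m & forall u, lex_lt u m -> size u = n -> ~ A u].
Proof.
elim: n A => [|n IHn] A AN [m mn Am].
  by exists m; split=> //; case: m mn {Am} => // _ [].
pose A1 a := exists2 v, size v = n & A (a :: v).
have A1N a : A1 a -> above_level N a by case=> v _ /AN /andP[].
have [|a [v vn Aav] amin] := letter_lt_min A1N.
  by case: m mn Am => // a m [mn] Am; exists a, m.
have [||v' [vn' Av' vmin]] := IHn (fun v => A (a :: v)).
- by move=> u /AN /andP[].
- by exists v.
exists (a :: v'); split=> //=; first by rewrite vn'.
move=> [|b u] //= [ba|[-> uv']] [un]; last exact: vmin.
by move=> Abu; apply: (amin b ba); exists u.
Qed.

(** The empty word is excluded because the series of interest have constant term 1; for these,
    [f - 1] has no monomial before [m0]. *)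
Definition tail_from m0 f := forall m, (0 < size m)%N -> word_lt m m0 -> f m = 0.

Lemma leading_word N f : f [::] = 1 -> supported (above_level N) f -> f <> 1 ->
  exists m0, [/\ (0 < size m0)%N, tail_from m0 f & f m0 <> 0].
Proof.
move=> f1 fN nf.
pose A m := (0 < size m)%N /\ f m <> 0.
have [m Am] : exists m, A m.
  apply: contrapT => nA; apply: nf; apply/funext => -[//|a m].
  by apply: contrapT => fm; apply: nA; exists (a :: m).
have exn : exists n, `[< exists2 m, size m = n & A m >].
  by exists (size m); apply/asboolP; exists m.
have [n /asboolP exm nmin] := ex_minnP exn.
have AN u : A u -> all (above_level N) u.
  by move=> [_ fu]; apply/negP => /negP /fN.
have [m0 [m0n [m0_gt0 fm0] m0min]] := lex_lt_min AN exm.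
exists m0; split=> // u u_gt0 [um0|[um0 lum0]]; apply: contrapT => fu.
  have : (n <= size u)%N by apply: nmin; apply/asboolP; exists u.
  by rewrite -m0n leqNgt um0.
by apply: (m0min u lum0); [rewrite um0|].
Qed.

Lemma tail_lowdeg m0 f : tail_from m0 f -> lowdeg (size m0) f.
Proof. by move=> fm m /andP[m_gt0 mm0]; apply: fm => //; left. Qed.

Lemma word_lt_size m u : word_lt m u -> (size m <= size u)%N.
Proof. by case=> [/ltnW|[->]]. Qed.

Lemma tail_fromW m0 m1 f : word_lt m0 m1 -> tail_from m1 f -> tail_from m0 f.
Proof. by move=> m01 fm m m_gt0 mm0; apply: fm => //; apply: word_lt_trans m01. Qed.

Section Tails.
Variables (m0 : seq letter) (f g : series letter).
Hypotheses (m0_gt0 : (0 < size m0)%N) (f1 : f [::] = 1) (g1 : g [::] = 1).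
Hypotheses (fm : tail_from m0 f).

Lemma tailM_coef m : (0 < size m <= size m0)%N -> (f * g) m = f m + g m.
Proof. exact: lowdegM (tail_lowdeg fm). Qed.

Lemma tailM : tail_from m0 g -> tail_from m0 (f * g).
Proof.
move=> gm m m_gt0 mm0; rewrite tailM_coef ?m_gt0 ?word_lt_size //.
by rewrite fm // gm.
Qed.

Lemma tailV_coef : series_inv f m0 = - f m0.
Proof. by rewrite (lowdegV f1 (tail_lowdeg fm)) // m0_gt0 /=. Qed.

Lemma tailV : tail_from m0 (series_inv f).
Proof.
move=> m m_gt0 mm0; rewrite (lowdegV f1 (tail_lowdeg fm)) ?m_gt0 ?word_lt_size //.
by rewrite fm // oppr0.
Qed.

Lemma tailJ_coef : (series_inv g * f * g) m0 = f m0.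
Proof. by rewrite (lowdegJ f1 g1 (tail_lowdeg fm)) // m0_gt0 /=. Qed.

Lemma tailJ : tail_from m0 (series_inv g * f * g).
Proof.
move=> m m_gt0 mm0.
by rewrite (lowdegJ f1 g1 (tail_lowdeg fm)) ?m_gt0 ?word_lt_size // fm.
Qed.

End Tails.

Lemma tail_shift k m0 f : tail_from m0 f -> tail_from (shift_word k m0) (shift k f).
Proof.
move=> fm m m_gt0 mm0; apply: fm; first by rewrite size_map.
have := word_lt_shift (- k) mm0.
by rewrite shift_wordD addNr shift_word0.
Qed.

Lemma shift_coef k m f : shift k f (shift_word k m) = f m.
Proof. by rewrite /shift shift_wordD addNr shift_word0. Qed.

Implicit Types s t : twisted Z.

Definition twisted_pos s : Prop := 0 < tw_exp s \/ tw_exp s = 0 /\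
  exists m, [/\ (0 < size m)%N, tail_from m (tw_ser s) & 0 < tw_ser s m].

(** When both exponents are 0, the leading word of the product is the smaller of the two leading
    words; if they coincide, their positive coefficients add. *)
Lemma twisted_posM s t : twisted_pos s -> twisted_pos t -> twisted_pos (s * t)%g.
Proof.
move=> [s_gt0|[s0 [m [m_gt0 sm sm_gt0]]]] [t_gt0|[t0 [u [u_gt0 tu tu_gt0]]]].
- by left; rewrite tw_expM; lia.
- by left; rewrite tw_expM t0; lia.
- by left; rewrite tw_expM s0; lia.
right; rewrite tw_expM tw_serM s0 t0 shift0; split=> //.
have [mu|mu|um] := word_lt_tri m u.
- exists m; split=> //; first by apply: tailM; rewrite ?tw_nil //; apply: tail_fromW tu.
  by rewrite (tailM_coef _ _ sm) ?tw_nil ?m_gt0 //= (tu m) // addr0.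
- rewrite -mu in tu tu_gt0 *; exists m; split=> //.
    by apply: tailM; rewrite ?tw_nil.
  by rewrite (tailM_coef _ _ sm) ?tw_nil ?m_gt0 //=; lia.
- have su := tail_fromW um sm.
  exists u; split=> //; first by apply: tailM; rewrite ?tw_nil.
  by rewrite (tailM_coef _ _ su) ?tw_nil ?u_gt0 //= (sm u) // add0r.
Qed.

Lemma tw_serJ s t : tw_exp s = 0 ->
  tw_ser (s ^ t)%g = series_inv (tw_ser t) * shift (tw_exp t) (tw_ser s) * tw_ser t.
Proof.
by move=> s0; rewrite conjgE !tw_serM /= s0 add0r shiftD subrr shift0 mulrA.
Qed.

(** The shift respects [word_lt], and conjugation by a series with constant term 1 preserves the
    leading term; so the leading word is shifted and keeps its coefficient. *)
Lemma twisted_posJ s t : twisted_pos s -> twisted_pos (s ^ t)%g.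
Proof.
have expJ : tw_exp (s ^ t)%g = tw_exp s by rewrite conjgE !tw_expM tw_expV; lia.
move=> [s_gt0|[s0 [m [m_gt0 sm sm_gt0]]]]; first by left; rewrite expJ.
right; rewrite expJ tw_serJ //; split=> //; exists (shift_word (tw_exp t) m).
have sh := tail_shift (k := tw_exp t) sm.
have m_gt0' : (0 < size (shift_word (tw_exp t) m))%N by rewrite size_map.
split=> //; first by apply: tailJ; rewrite ?shift_nil ?tw_nil.
by rewrite tailJ_coef ?shift_nil ?tw_nil ?shift_coef.
Qed.

Lemma twisted_pos_tri s N : supported (above_level N) (tw_ser s) ->
  [\/ twisted_pos s, s = 1%g | twisted_pos (s^-1)%g].
Proof.
move=> sN; case: (ltgtP (tw_exp s) 0) => [s_lt0|s_gt0|s0].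
- by constructor 3; left; rewrite tw_expV; lia.
- by constructor 1; left.
case: (pselect (tw_ser s = 1)) => [s1|s1]; first by constructor 2; apply: twistedP.
have [m [m_gt0 sm sm0]] := leading_word (tw_nil s) sN s1.
case: (ltgtP (tw_ser s m) 0) => [sm_lt0|sm_gt0|//].
  constructor 3; right; rewrite tw_expV s0; split=> //; exists m.
  rewrite /= s0 oppr0 shift0 tailV_coef ?tw_nil //.
  by split=> //; [apply: tailV; rewrite ?tw_nil|lia].
by constructor 1; right; split=> //; exists m.
Qed.

Lemma twisted_pos1 : ~ twisted_pos 1%g.
Proof. by case=> [//|[_ [[|a m] [//]]]]. Qed.

(** A general series may have no least monomial; a lower bound on the levels provides one. The bound
    may depend on the element. *)
Definition bounded : set (twisted Z) :=
  [set s | exists N, supported (above_level N) (tw_ser s)]%classic.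

Lemma supported_shift N k f : supported (above_level N) f ->
  supported (above_level (N - k)) (shift k f).
Proof.
move=> fN m; rewrite /shift => mN; apply: fN; apply: contra mN.
by rewrite all_shift_word; apply: sub_all => -[[z j]|] //=; lia.
Qed.

Lemma above_levelW (N N' : int) : N <= N' -> {subset above_level N <= above_level N'}.
Proof. by move=> NN' [[z j]|] //; rewrite !unfold_in /=; lia. Qed.

Lemma bounded_subgroup : subgroup bounded.
Proof.
apply/subgroupP; split=> [|s t [N sN] [N' tN]|s [N sN]].
- by exists 0; apply: supported1.
- exists (Num.max (N - tw_exp t) N'); rewrite tw_serM; apply: supportedM.
    apply: (supportedW _ (supported_shift (k := tw_exp t) sN)).
    by apply: above_levelW; lia.
  by apply: (supportedW _ tN); apply: above_levelW; lia.
- by exists (N - - tw_exp s); apply: supported_shift; apply: supported_inv.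
Qed.

Lemma xy_rep_bounded (w : free_group Z) (g : xy_group w) : bounded (xy_rep g).
Proof.
move: g; apply: (@xy_group_ind _ _ [set g | bounded (xy_rep g)]%classic).
  exact: (preimage_subgroup _ bounded_subgroup).
move=> s; rewrite /= xy_rep_gen; exists 0; case: s => [||z] /=.
- exact: supported1.
- apply: supportedM; first exact: supported_var.
  apply: supported_inv; apply: supportedW (supported_w_limit w) => -[[z j]|] //.
  by rewrite !unfold_in /=; lia.
- exact: supported_var.
Qed.

Definition xy_pos (w : free_group Z) : set (xy_group w) :=
  [set g | twisted_pos (xy_rep g)]%classic.

Lemma xy_pos_cone (w : free_group Z) : positive_cone (@xy_pos w).
Proof.
split=> [a b|a g|a|]; rewrite /xy_pos /=.
- by rewrite xy_repM; apply: twisted_posM.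
- by rewrite xy_repJ; apply: twisted_posJ.
- have [N aN] := xy_rep_bounded a; rewrite xy_repV.
  by case: (twisted_pos_tri aN) => [?|/xy_rep_inj ?|?];
    [constructor 1|constructor 2|constructor 3].
- by rewrite xy_rep1; apply: twisted_pos1.
Qed.

Lemma xy_jump (w : free_group Z) (c : xy_group w) : c <> 1%g ->
  exists V (E : xy_group w -> int),
    [/\ subgroup V, V c, forall v p, V v -> xy_pos p -> ~ V p -> xy_pos (v * p)%g,
        forall p q, V p -> V q -> E (p * q)%g = E p + E q & E c <> 0].
Proof.
move=> c1; case: (eqVneq (tw_exp (xy_rep c)) 0) => [c0|/eqP c0]; last first.
  exists setT, (fun p => tw_exp (xy_rep p)); split=> // [|a b _ _].
    by apply/subgroupP.
  by rewrite xy_repM tw_expM.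
have [N cN] := xy_rep_bounded c.
have [|m [m_gt0 cm cm0]] := leading_word (tw_nil (xy_rep c)) cN.
  by move=> rc1; apply: c1; apply: xy_rep_inj; apply: twistedP.
exists [set p | tw_exp (xy_rep p) = 0 /\ tail_from m (tw_ser (xy_rep p))]%classic.
exists (fun p => tw_ser (xy_rep p) m); split=> //.
- apply/subgroupP; split=> [|a b [a0 am] [b0 bm]|a [a0 am]] /=.
  + by rewrite xy_rep1; split=> // -[].
  + rewrite xy_repM tw_expM tw_serM a0 b0 shift0; split=> //.
    by apply: tailM; rewrite ?tw_nil.
  + rewrite xy_repV tw_expV /= a0 oppr0 shift0; split=> //.
    by apply: tailV; rewrite ?tw_nil.
- move=> v p [v0 vm] [p_gt0|[p0 [u [u_gt0 pu pu_gt0]]]] nVp.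
    by left; rewrite xy_repM tw_expM v0 add0r.
  right; rewrite xy_repM tw_expM tw_serM v0 p0 shift0; split=> //; exists u.
  (* The leading word [u] of [p] precedes [m], as otherwise [p] would lie in [V]. The series of [v]
     vanishes at [u], so [v p] keeps the leading term of [p]. *)
  have [mu|mu|um] := word_lt_tri m u.
  + by case: nVp; split=> //; apply: tail_fromW pu.
  + by case: nVp; rewrite mu.
  have vu := tail_fromW um vm.
  split=> //; first by apply: tailM; rewrite ?tw_nil.
  by rewrite (tailM_coef _ _ vu) ?tw_nil ?u_gt0 //= (vm u) // add0r.
- move=> a b [a0 am] [b0 bm]; rewrite xy_repM tw_serM b0 shift0.
  by rewrite (tailM_coef _ _ am) ?tw_nil ?m_gt0 /=.
Qed.

End SeriesOrder.

Theorem proposition25 (Z : Type) (w : free_group Z) (C : set (xy_group w)) :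
  maximal_cyclic_subgroup C -> left_relatively_convex C.
Proof.
(* [Z] is arbitrary, so a well-order is chosen on it to make least monomials available. *)
have [zlt [zlt_trans zlt_tri zlt_min]] := strict_well_order Z.
apply: (maximal_cyclic_convex (xy_pos_cone zlt_trans zlt_tri zlt_min w)).
exact: xy_jump.
Qed.
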